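(* For every $\delta$ with $0\le\delta<1$, the function $w(x)/|x|^{\delta}$ (extended by $0$ at the origin) is a viscosity solution in the unit ball $B\subset\mathbf{R}^{12}$ of a uniformly elliptic Hessian equation $F(D^2u)=0$. That is, for every such $\delta$ there exists a Lipschitz function $F$ on $S^2(\mathbf{R}^{12})$ which is uniformly elliptic and $O(12)$-invariant, such that $w/|x|^\delta$ is a viscosity solution of $F(D^2u)=0$ in $B$.
   Context: $B=\{x\in\mathbf{R}^{12}:|x|<1\}$. Identify $\mathbf{R}^{12}$ with $\mathbf{H}^3$, where $\mathbf{H}$ is the algebra of Hamilton quaternions, identified with $\mathbf{R}^4$ via $(t_0,t_1,t_2,t_3)\mapsto t_0+t_1i+t_2j+t_3k$. For $x=(q_1,q_2,q_3)\in\mathbf{H}^3$ set $w(x)=\mathrm{Re}(q_1q_2q_3)/|x|$ for $x\ne0$, and $w(0)=0$. $S^2(\mathbf{R}^n)$ is the space of real symmetric $n\times n$ matrices. $F:S^2(\mathbf{R}^n)\to\mathbf{R}$ is uniformly elliptic if there is a constant $C\ge1$ (an ellipticity constant) such that $C^{-1}\|N\|\le F(M+N)-F(M)\le C\|N\|$ for all $M\in S^2(\mathbf{R}^n)$ and all non-negative definite $N\in S^2(\mathbf{R}^n)$. The equation $F(D^2u)=0$ is called Hessian if $F(S)$ depends only on the eigenvalues of $S$, equivalently $F({}^tO\,S\,O)=F(S)$ for all $O\in O(n)$. A continuous function $u$ on an open set $\Omega$ is a viscosity solution of $F(D^2u)=0$ in $\Omega$ if for every $x_0\in\Omega$ and every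 $C^2$ function $\varphi$ near $x_0$: $F(D^2\varphi(x_0))\ge0$ whenever $u-\varphi$ has a local maximum at $x_0$, and $F(D^2\varphi(x_0))\le0$ whenever $u-\varphi$ has a local minimum at $x_0$. *)

(* Defs.v *)
From HB Require Import structures.
From mathcomp Require Import all_boot all_order all_algebra.
From mathcomp Require Import sesquilinear ring.
From mathcomp Require Import all_classical all_reals all_analysis.

Set Implicit Arguments.
Unset Strict Implicit.
Unset Printing Implicit Defensive.

Import Order.TTheory GRing.Theory Num.Theory.
Import numFieldNormedType.Exports.

Local Open Scope classical_set_scope.
Local Open Scope ring_scope.

(* Euclidean norm of a vector, Frobenius norm of a matrix; the library norm
   `|A| on matrices is the maximum of the absolute values of the entries. *)
Definition enorm (R : realType) (m n : nat) (A : 'M[R]_(m, n)) : R :=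
  Num.sqrt (\sum_i \sum_j A i j ^+ 2).

Definition unit_ball (R : realType) (n : nat) : set 'rV[R]_n :=
  [set x | enorm x < 1].

Record quaternion (R : Type) := Quaternion { q0 : R; q1 : R; q2 : R; q3 : R }.

Definition qmul (R : comPzRingType) (p q : quaternion R) : quaternion R :=
  Quaternion
    (q0 p * q0 q - q1 p * q1 q - q2 p * q2 q - q3 p * q3 q)
    (q0 p * q1 q + q1 p * q0 q + q2 p * q3 q - q3 p * q2 q)
    (q0 p * q2 q - q1 p * q3 q + q2 p * q0 q + q3 p * q1 q)
    (q0 p * q3 q + q1 p * q2 q - q2 p * q1 q + q3 p * q0 q).

Lemma qmulA (R : comPzRingType) : associative (@qmul R).
Proof. by move=> a b c; rewrite /qmul /=; congr Quaternion; ring. Qed.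

(* The [a]-th component (a = 0, 1, 2) of a vector of R^12 = H^3. *)
Definition qcomp (R : realType) (x : 'rV[R]_12) (a : nat) : quaternion R :=
  Quaternion (x 0 (inord (4 * a)))     (x 0 (inord (4 * a + 1)))
             (x 0 (inord (4 * a + 2))) (x 0 (inord (4 * a + 3))).

Definition w (R : realType) (x : 'rV[R]_12) : R :=
  if x == 0 then 0
  else q0 (qmul (qmul (qcomp x 0) (qcomp x 1)) (qcomp x 2)) / enorm x.

Definition w_delta (R : realType) (delta : R) (x : 'rV[R]_12) : R :=
  if x == 0 then 0 else w x / enorm x `^ delta.

(* Functions on S^2(R^n).  They are represented by functions on all matrices,
    of which only the values at symmetric matrices are constrained or used. *)

Lemma symmetricmxP (R : realType) (n : nat) (M : 'M[R]_n) :
  reflect (M^T = M) (M \is symmetricmx).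
Proof.
rewrite qualifE /= expr0 scale1r map_mx_id // eq_sym.
exact: eqP.
Qed.

Definition nonneg_definite (R : realType) (n : nat) (N : 'M[R]_n) : Prop :=
  N \is symmetricmx /\ forall v : 'rV[R]_n, 0 <= (v *m N *m v^T) 0 0.

Definition uniformly_elliptic (R : realType) (n : nat) (F : 'M[R]_n -> R) :
    Prop :=
  exists2 C : R, 1 <= C &
    forall M N : 'M[R]_n, M \is symmetricmx -> nonneg_definite N ->
      C^-1 * enorm N <= F (M + N) - F M <= C * enorm N.

Definition lipschitz_sym (R : realType) (n : nat) (F : 'M[R]_n -> R) : Prop :=
  exists L : R, forall M N : 'M[R]_n,
    M \is symmetricmx -> N \is symmetricmx ->
    `|F M - F N| <= L * enorm (M - N).

Definition orthogonal_invariant (R : realType) (n : nat) (F : 'M[R]_n -> R) :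
    Prop :=
  forall O S : 'M[R]_n, O^T *m O = 1%:M -> S \is symmetricmx ->
    F (O^T *m S *m O) = F S.

Definition partial (R : realType) (n : nat) (i : 'I_n) (f : 'rV[R]_n -> R)
  (x : 'rV[R]_n) : R := derive f x (delta_mx 0 i).

Definition hessian (R : realType) (n : nat) (f : 'rV[R]_n -> R)
  (x : 'rV[R]_n) : 'M[R]_n := \matrix_(i, j) partial i (partial j f) x.

Definition C1_near (R : realType) (n : nat) (x0 : 'rV[R]_n)
    (f : 'rV[R]_n -> R) : Prop :=
  \forall x \near x0, {for x, continuous f} /\
    forall i : 'I_n,
      derivable f x (delta_mx 0 i) /\ {for x, continuous (partial i f)}.

Definition C2_near (R : realType) (n : nat) (x0 : 'rV[R]_n)
    (f : 'rV[R]_n -> R) : Prop :=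
  C1_near x0 f /\ forall i : 'I_n, C1_near x0 (partial i f).

Definition local_max (R : realType) (n : nat) (f : 'rV[R]_n -> R)
    (x0 : 'rV[R]_n) : Prop :=
  \forall x \near x0, f x <= f x0.

Definition local_min (R : realType) (n : nat) (f : 'rV[R]_n -> R)
    (x0 : 'rV[R]_n) : Prop :=
  \forall x \near x0, f x0 <= f x.

Definition viscosity_solution (R : realType) (n : nat) (F : 'M[R]_n -> R)
    (Omega : set 'rV[R]_n) (u : 'rV[R]_n -> R) : Prop :=
  {within Omega, continuous u} /\
  forall (x0 : 'rV[R]_n) (phi : 'rV[R]_n -> R),
    Omega x0 -> C2_near x0 phi ->
    (local_max (u \- phi) x0 -> 0 <= F (hessian phi x0)) /\
    (local_min (u \- phi) x0 -> F (hessian phi x0) <= 0).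

(* Main.v *)
(** Write [w_delta = P / |x|^s] with [P = Re (q1 q2 q3)] and [s = 1 + delta < 2]. For a unit
    vector [e] with [m = P e], the Hessian of [P] at [e] has as eigenvalues the roots of
    [T^3 - T + 2m], twice, and those of [T^3 - T - 2M] and [T^3 - T + 2M], once, where
    [M = |q1| |q2| |q3| >= |m|]. The middle root [b] of [T^3 - T + 2m] increases with [m] at
    rate at least 2, hence [b - s m] increases at rate at least [2 - s > 0], whereas the trace
    of the Hessian of the solution is a negative multiple of [m]. Comparing subspaces by a
    dimension count shows that, for any two Hessians [A], [B] of the solution, possibly rotated
    and rescaled, [tr B - tr A <= K lambda_max (A - B)] with a fixed constant [K].
    Consequently the function
      [F M = inf_A (tr (M - A) + K lambda_max (M - A))],
    an infimum over all these [A], is uniformly elliptic and rotation invariant, and vanishes at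
    every Hessian of the solution. At the origin one uses that the solution is odd and that the
    zero matrix is one of the [A]. *)

Require Import Defs.
From HB Require Import structures.
From mathcomp Require Import all_boot all_order all_algebra.
From mathcomp Require Import ring lra sesquilinear.
From mathcomp Require Import all_classical all_reals all_analysis.

Set Implicit Arguments.
Unset Strict Implicit.
Unset Printing Implicit Defensive.

Import Order.TTheory GRing.Theory Num.Theory.
Import numFieldNormedType.Exports.

Local Open Scope ring_scope.

(** * Quadratic forms and codimension *)

Section QuadraticForms.
Variable R : realType.

(** The Hessian of the solution is homogeneous in [x], so up to rotation the family of [A] consists
    of rays [t * A_e], with [e] a unit vector and [t >= 0]. Two members share neither eigenvectors
    nor scale; only the positions of their eigenvalues can be compared, through subspaces of
    codimensions [k] and [k'] with [k + k' < 12]. Among the twelve ordered eigenvalues of the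
    Hessian of [P] at [e], the top root [a] takes places 2 and 3 and the middle root [b] places 6
    and 7. Passing from [P] to the solution costs one dimension in lower bounds and none in upper
    bounds. The budget is therefore 6 + 5 for middle against middle and 10 + 1 for top against top:
    11 in both cases, which just fits.

    The constant is [K = s (16 - s) / (2 - s)]. Since [P] is a harmonic cubic in dimension 12, the
    trace at [e] is [- s (16 - s) P(e)], while the eigenvalue gap is at least [2 - s] times the
    difference of the scaled values [t P(e)]. This quotient blows up as [delta] tends to 1.

    Eigenvalues are never diagonalized: inequalities on kernels replace their order, and traces of
    idempotents replace their multiplicities. *)

Definition dot n (u v : 'rV[R]_n) : R := \sum_i u 0 i * v 0 i.
Definition qform n (A : 'M[R]_n) (v : 'rV[R]_n) : R := dot (v *m A) v.

Lemma dotE n (u v : 'rV[R]_n) : dot u v = (u *m v^T) 0 0.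
Proof. by rewrite mxE; apply: eq_bigr => i _; rewrite mxE. Qed.

Lemma dotC n (u v : 'rV[R]_n) : dot u v = dot v u.
Proof. by apply: eq_bigr => i _; rewrite mulrC. Qed.

Lemma dotDl n (u u' v : 'rV[R]_n) : dot (u + u') v = dot u v + dot u' v.
Proof. by rewrite !dotE mulmxDl mxE. Qed.

Lemma dotZl n a (u v : 'rV[R]_n) : dot (a *: u) v = a * dot u v.
Proof. by rewrite !dotE -scalemxAl mxE. Qed.

Lemma dotDr n (u v v' : 'rV[R]_n) : dot u (v + v') = dot u v + dot u v'.
Proof. by rewrite dotC dotDl !(dotC u). Qed.

Lemma dotZr n a (u v : 'rV[R]_n) : dot u (a *: v) = a * dot u v.
Proof. by rewrite dotC dotZl dotC. Qed.

Lemma dotNl n (u v : 'rV[R]_n) : dot (- u) v = - dot u v.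
Proof. by rewrite -scaleN1r dotZl mulN1r. Qed.

Lemma dotNr n (u v : 'rV[R]_n) : dot u (- v) = - dot u v.
Proof. by rewrite dotC dotNl dotC. Qed.

Lemma dot0l n (v : 'rV[R]_n) : dot 0 v = 0.
Proof. by rewrite -(scale0r 0) dotZl mul0r. Qed.

Lemma dot_ge0 n (v : 'rV[R]_n) : 0 <= dot v v.
Proof. by apply: sumr_ge0 => i _; rewrite -expr2 sqr_ge0. Qed.

Lemma dot_eq0 n (v : 'rV[R]_n) : (dot v v == 0) = (v == 0).
Proof.
apply/eqP/eqP => [|->]; last exact: dot0l.
move=> /eqP; rewrite psumr_eq0 => [|i _]; last by rewrite -expr2 sqr_ge0.
move=> /allP h; apply/rowP => i; rewrite mxE.
by have := h i (mem_index_enum i); rewrite -expr2 sqrf_eq0 => /eqP.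
Qed.

Lemma dot_gt0 n (v : 'rV[R]_n) : (0 < dot v v) = (v != 0).
Proof. by rewrite lt_def dot_ge0 andbT dot_eq0. Qed.

Lemma dot_delta n (i : 'I_n) : dot (delta_mx 0 i) (delta_mx 0 i : 'rV[R]_n) = 1.
Proof. by rewrite dotE trmx_delta -colE !mxE !eqxx. Qed.

Lemma enorm_row n (x : 'rV[R]_n) : enorm x = Num.sqrt (dot x x).
Proof. by rewrite /enorm big_ord1; congr Num.sqrt; apply: eq_bigr => i _; rewrite expr2. Qed.

Lemma sqr_enorm n (x : 'rV[R]_n) : enorm x ^+ 2 = dot x x.
Proof. by rewrite enorm_row sqr_sqrtr // dot_ge0. Qed.

Lemma enorm_gt0 n (x : 'rV[R]_n) : (0 < enorm x) = (x != 0).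
Proof. by rewrite enorm_row sqrtr_gt0 dot_gt0. Qed.

Lemma dot_normalize n (x : 'rV[R]_n) (e := (enorm x)^-1 *: x) : x != 0 -> dot e e = 1.
Proof.
by rewrite -enorm_gt0 => x0; rewrite dotZl dotZr -sqr_enorm; field; rewrite gt_eqF.
Qed.

Lemma dot_mulmxl n p (u : 'rV[R]_n) (A : 'M[R]_(n, p)) v :
  dot (u *m A) v = dot u (v *m A^T).
Proof. by rewrite !dotE trmx_mul trmxK mulmxA. Qed.

(** For a quadratic form this says that at most [k] eigenvalues are negative. Encoding the subspace
    as the kernel of a linear map makes it easy to pull back along linear maps and to intersect,
    codimensions adding up. *)
Definition nonneg_codim n k (g : 'rV[R]_n -> R) : Prop :=
  exists2 f : 'rV[R]_n -> 'rV[R]_k, linear f & forall v, f v = 0 -> 0 <= g v.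

Lemma nonneg_codim_le n k (g h : 'rV[R]_n -> R) :
  (forall v, g v <= h v) -> nonneg_codim k g -> nonneg_codim k h.
Proof. by move=> gh [f fl fg]; exists f => // v /fg; move/le_trans; apply. Qed.

Lemma nonneg_codim_mx n k (L : 'M[R]_(n, k)) (g : 'rV[R]_n -> R) :
  (forall v, v *m L = 0 -> 0 <= g v) -> nonneg_codim k g.
Proof. by exists (mulmx^~ L) => // a u v; rewrite mulmxDl scalemxAl. Qed.

Lemma linear_lin1_mx n k (f : 'rV[R]_n -> 'rV[R]_k) :
  linear f -> exists L : 'M[R]_(n, k), forall v, f v = v *m L.
Proof.
move=> fl; pose fL := GRing.isLinear.Build _ _ _ _ f fl.
pose F : {linear 'rV[R]_n -> 'rV[R]_k} := HB.pack f fL.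
by exists (lin1_mx F) => v; rewrite mul_rV_lin1.
Qed.

Lemma nonneg_codimP n k (g : 'rV[R]_n -> R) : nonneg_codim k g ->
  exists L : 'M[R]_(n, k), forall v, v *m L = 0 -> 0 <= g v.
Proof.
by move=> [f /linear_lin1_mx[L fL] fg]; exists L => v; rewrite -fL => /fg.
Qed.

Lemma nonneg_codim_rank n k r (L : 'M[R]_(n, r)) (g : 'rV[R]_n -> R) :
  (\rank L <= k)%N -> (forall v, v *m L = 0 -> 0 <= g v) -> nonneg_codim k g.
Proof.
(* [L] may have many columns: [col_base L] keeps [\rank L] of them without changing the kernel, and
   [pid_mx] pads with zero columns up to [k]. *)
move=> rk Lg; apply: (@nonneg_codim_mx _ _ (col_base L *m pid_mx (\rank L))) => v.
rewrite mulmxA => v0; apply: Lg; rewrite -(mulmx_base L) mulmxA.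
suff -> : v *m col_base L = 0 by rewrite mul0mx.
have := congr1 (mulmx^~ (pid_mx (\rank L) : 'M[R]_(k, \rank L))) v0.
by rewrite /= mul0mx -mulmxA mul_pid_mx minnn (minn_idPr rk) pid_mx_1 mulmx1.
Qed.

Lemma nonneg_codim_leq n k k' (g : 'rV[R]_n -> R) :
  (k <= k')%N -> nonneg_codim k g -> nonneg_codim k' g.
Proof.
move=> kk' /nonneg_codimP[L Lg]; apply: (nonneg_codim_rank _ Lg).
exact: leq_trans (rank_leq_col L) kk'.
Qed.

Lemma nonneg_codim_comp n p k (h : 'rV[R]_n -> 'rV[R]_p) (g : 'rV[R]_p -> R) :
  linear h -> nonneg_codim k g -> nonneg_codim k (g \o h).
Proof.
by move=> hl [f fl fg]; exists (f \o h) => [a u v|v /fg//]; rewrite /= hl fl.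
Qed.

Lemma nonneg_codim_meet n k k' (g g' : 'rV[R]_n -> R) :
  nonneg_codim k g -> nonneg_codim k' g' ->
  exists2 L : 'M[R]_(n, k + k'), True & forall v, v *m L = 0 -> 0 <= g v /\ 0 <= g' v.
Proof.
move=> /nonneg_codimP[L Lg] /nonneg_codimP[L' Lg']; exists (row_mx L L') => // v.
by rewrite mul_mx_row -row_mx0 => /eq_row_mx[/Lg ? /Lg' ?].
Qed.

Lemma nonneg_codimD n k k' (g g' : 'rV[R]_n -> R) :
  nonneg_codim k g -> nonneg_codim k' g' -> nonneg_codim (k + k') (g \+ g').
Proof.
move=> gk /(nonneg_codim_meet gk)[L _ h]; apply: (nonneg_codim_mx (L := L)) => v.
by move=> /h[? ?]; rewrite addr_ge0.
Qed.

Lemma nonneg_codim_exists n k k' (g g' : 'rV[R]_n -> R) :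
  (k + k' < n)%N -> nonneg_codim k g -> nonneg_codim k' g' ->
  exists2 v, v != 0 & 0 <= g v /\ 0 <= g' v.
Proof.
move=> kn gk /(nonneg_codim_meet gk)[L _ h].
have : kermx L != 0.
  rewrite -mxrank_eq0 mxrank_ker subn_eq0 -ltnNge.
  exact: leq_ltn_trans (rank_leq_col L) kn.
move=> /rowV0Pn[v /sub_kermxP /h vL v0]; by exists v.
Qed.

(** In a rank factorization [K = C *m D], idempotency forces [D *m C = 1%:M], and the trace is
    cyclic. Multiplicities of eigenvalues will be read off from traces in this way. *)
Lemma rank_idempotent n (K : 'M[R]_n) : K *m K = K -> (\rank K)%:R = \tr K :> R.
Proof.
move=> KK.
have [C' CC'] := row_fullP (col_base_full K).
have [D' DD'] := row_freeP (row_base_free K).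
move: C' D' CC' DD'; move: (col_base K) (row_base K) (mulmx_base K).
move: (\rank K) => r C D CDK C' D' CC' DD'.
have DC : D *m C = 1%:M.
  move: KK; rewrite -CDK => /(congr1 (fun M => C' *m M *m D')).
  by rewrite !mulmxA CC' mul1mx -!mulmxA DD' mulmx1.
rewrite -CDK mxtrace_mulC DC mxtrace1 //.
Qed.

End QuadraticForms.

(** * Symmetric matrices annihilated by a split cubic *)

Section SymmetricCubic.
Variables (R : realType) (n : nat) (H : 'M[R]_n).
Hypothesis Hsym : H^T = H.

Local Notation D a := (H - a%:M).

Let vD (v : 'rV[R]_n) a : v *m D a = v *m H - a *: v.
Proof. by rewrite mulmxBr mul_mx_scalar. Qed.

Lemma shift_mulC a b : D a *m D b = D b *m D a.
Proof.
rewrite !mulmxBl !mulmxBr !mul_mx_scalar !mul_scalar_mx.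
by apply/matrixP => i j; rewrite !mxE; ring.
Qed.

Let D_shift a b : D a = D b + (b - a)%:M.
Proof. by rewrite raddfB /= addrA subrK. Qed.

Let D_sym a : (D a)^T = D a.
Proof. by rewrite raddfB /= Hsym tr_scalar_mx. Qed.

Let dotD (u v : 'rV[R]_n) a : dot (u *m D a) v = dot u (v *m D a).
Proof. by rewrite dot_mulmxl D_sym. Qed.

Lemma qform_shift (v : 'rV[R]_n) a : dot (v *m D a) v = qform H v - a * dot v v.
Proof. by rewrite vD dotDl dotNl dotZl. Qed.

(** The vector [u = v (H - b)] is killed by [H - a], so [|u|^2 = (a - b) (u . v)], and [u . v] is
    the quantity to be shown nonnegative. If [a = b] then [u = 0]: symmetry excludes Jordan
    blocks. *)
Lemma qform_ge_of_quad (v : 'rV[R]_n) a b : b <= a -> v *m D a *m D b = 0 ->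
  b * dot v v <= qform H v.
Proof.
move=> ba v0; rewrite -subr_ge0 -qform_shift.
set u := v *m D b.
have ua : u *m D a = 0 by rewrite -mulmxA shift_mulC mulmxA.
have uu : dot u u = (a - b) * dot u v.
  by rewrite {2}/u -dotD (D_shift b a) mulmxDr ua add0r mul_mx_scalar dotZl.
have := dot_ge0 u; rewrite uu le_eqVlt in ba *.
case/predU1P: ba uu => [->|ba _]; last by rewrite pmulr_rge0 ?subr_gt0.
by rewrite subrr mul0r => /eqP; rewrite dot_eq0 => /eqP ->; rewrite dot0l.
Qed.

Variables (k : nat) (a b c : R).
Hypothesis nk : n = (3 * k)%N.
Hypothesis cubic : D a *m D b *m D c = 0.
Hypothesis trH : \tr H = k%:R * (a + b + c).
Hypothesis trHH : \tr (H *m H) = k%:R * (a ^+ 2 + b ^+ 2 + c ^+ 2).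

Lemma mulmx_tr_eq0 p (M : 'M[R]_(n, p)) : M *m M^T = 0 -> M = 0.
Proof.
move=> M0; apply/row_matrixP => i; apply/eqP; rewrite row0 -dot_eq0.
apply/eqP; transitivity ((M *m M^T) i i); last by rewrite M0 mxE.
by rewrite mxE; apply: eq_bigr => j _; rewrite !mxE.
Qed.

Lemma mul_quad_quad a' b' c' : D a' *m D b' *m D c' = 0 ->
  D a' *m D b' *m (D a' *m D b') = ((c' - a') * (c' - b')) *: (D a' *m D b').
Proof.
move=> K0; set K := D a' *m D b'.
have KD d : K *m D d = (c' - d) *: K.
  by rewrite (D_shift d c') mulmxDr K0 add0r mul_mx_scalar.
by rewrite mulmxA KD -scalemxAl KD scalerA.
Qed.

(** The product is [(c - a) (c - b)] times an idempotent, whose rank is its trace; the trace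
    hypotheses say that each root counts [k] times. *)
Lemma rank_quad : (c - a) * (c - b) != 0 -> \rank (D a *m D b) = k.
Proof.
set t := _ * _ => t0; set K := D a *m D b.
have KK : (t^-1 *: K) *m (t^-1 *: K) = t^-1 *: K.
  by rewrite -scalemxAl -scalemxAr (mul_quad_quad cubic) !scalerA -/t -mulrA mulVf // mulr1.
apply/eqP; rewrite -(eqr_nat R) -(mxrank_scale_nz K (invr_neq0 t0)).
rewrite (rank_idempotent KK) mxtraceZ /K mulmxBl !mulmxBr.
rewrite !mul_mx_scalar !mul_scalar_mx !raddfB /= !mxtraceZ mxtrace_scalar.
rewrite trH trHH nk -[a *+ _]mulr_natr natrM; apply/eqP/(mulfI t0).
rewrite mulVKf // /t.
by ring.
Qed.

(** When [c] coincides with another root the product squares to zero, and it is symmetric. *)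
Lemma quad_eq0 : (c - a) * (c - b) = 0 -> D a *m D b = 0.
Proof.
move=> t0; apply: mulmx_tr_eq0; rewrite trmx_mul !D_sym.
by rewrite (shift_mulC b a) (mul_quad_quad cubic) t0 scale0r.
Qed.

End SymmetricCubic.

Section CubicCodim.
Variables (R : realType) (n : nat) (H : 'M[R]_n) (k : nat) (a b c : R).
Hypothesis Hsym : H^T = H.
Hypothesis nk : n = (3 * k)%N.
Hypothesis cubic : (H - a%:M) *m (H - b%:M) *m (H - c%:M) = 0.
Hypothesis trH : \tr H = k%:R * (a + b + c).
Hypothesis trHH : \tr (H *m H) = k%:R * (a ^+ 2 + b ^+ 2 + c ^+ 2).
Hypotheses (cb : c <= b) (ba : b <= a).

(** The subspace is the kernel of [(H - a) (H - b)]. The rank of this product is the multiplicity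
    [k] of [c], or zero if [c] coincides with another root. *)
Lemma cubic_codim_mid : nonneg_codim k (fun v => qform H v - b * dot v v).
Proof.
apply: (nonneg_codim_rank (L := (H - a%:M) *m (H - b%:M))).
  have [/(quad_eq0 Hsym cubic) ->|t0] := eqVneq ((c - a) * (c - b)) 0.
    by rewrite mxrank0.
  by rewrite (rank_quad nk cubic).
move=> v v0; rewrite subr_ge0; apply: (qform_ge_of_quad Hsym ba).
by rewrite -mulmxA.
Qed.

(** If [a] differs from [b] and [c], the product [(H - b) (H - c)] has rank [k], which leaves at
    most [3 k - k] for the rank of [H - a]. *)
Lemma cubic_codim_top : nonneg_codim (2 * k) (fun v => qform H v - a * dot v v).
Proof.
have [ba'|ba'] := eqVneq b a.
  by rewrite -ba'; apply: nonneg_codim_leq cubic_codim_mid; rewrite leq_pmull.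
apply: (nonneg_codim_rank (L := H - a%:M)); last first.
  by move=> v v0; rewrite -qform_shift v0 dot0l.
have ab : b < a by rewrite lt_neqAle ba'.
have bca : (H - b%:M) *m (H - c%:M) *m (H - a%:M) = 0.
  by rewrite -mulmxA (shift_mulC H c a) mulmxA (shift_mulC H b a).
have rk : \rank ((H - b%:M) *m (H - c%:M)) = k.
  apply: (rank_quad nk bca).
  - by rewrite trH -addrA addrC.
  - by rewrite trHH -addrA addrC.
  - by rewrite mulf_neq0 // subr_eq0 gt_eqF // (le_lt_trans cb).
have := mulmx0_rank_max (etrans (mulmxA _ _ _) cubic).
by rewrite rk => h; rewrite -(leq_add2r k) -mulSnr -nk.
Qed.

(** At the three roots [(T - a) (T - c) <= 0 <= (T - a)^2], and the two sides differ by
    [(a - c) (a - T)]. [quad_le0] is the first inequality in terms of quadratic forms. *)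
Lemma cubic_le_top v : qform H v <= a * dot v v.
Proof.
have acb : (H - a%:M) *m (H - c%:M) *m (H - b%:M) = 0.
  by rewrite -mulmxA (shift_mulC H c b) mulmxA.
pose s1 := qform H v; pose s2 := dot (v *m H) (v *m H).
have dotH (x y : 'rV[R]_n) : dot (x *m H) y = dot x (y *m H).
  by rewrite dot_mulmxl Hsym.
have sqrE : dot (v *m H - a *: v) (v *m H - a *: v) =
    s2 - 2 * a * s1 + a ^+ 2 * dot v v.
  rewrite !(dotDl, dotDr, dotNl, dotNr, dotZl, dotZr) (dotC v) -/s2 -/(qform H v).
  by rewrite -/s1; ring.
have quad : dot (v *m (H - a%:M) *m (H - c%:M)) v =
    s2 - (a + c) * s1 + a * c * dot v v.
  rewrite mulmxBr mul_mx_scalar mulmxBr mul_mx_scalar mulmxBl -scalemxAl.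
  rewrite !(dotDl, dotNl, dotZl, scalerBr) dotH -/s2 -/(qform H v) -/s1.
  by ring.
have ac : c <= a by exact: le_trans ba.
have quad_le0 : s2 - (a + c) * s1 + a * c * dot v v <= 0.
  rewrite -quad; have [ab|ab] := eqVneq a b.
    by rewrite -mulmxA (quad_eq0 Hsym acb) ?mulmx0 ?dot0l // ab subrr mul0r.
  have : c * dot (v *m (H - a%:M)) (v *m (H - a%:M)) <= qform H (v *m (H - a%:M)).
    apply: (qform_ge_of_quad Hsym cb).
    by rewrite -!mulmxA [X in v *m X]mulmxA cubic mulmx0.
  (* [y] satisfies [y H = b y] and pairs nonnegatively with [v (H - a)]. This pairing equals
     [(b - a) (y . v)], hence [y . v <= 0]. *)
  set y := v *m (H - a%:M) *m (H - c%:M).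
  have yH : y *m H = b *: y.
    apply/eqP; rewrite -subr_eq0 -mul_mx_scalar -mulmxBr /y -!mulmxA.
    by rewrite [X in v *m X]mulmxA acb mulmx0.
  rewrite -subr_ge0 -qform_shift -/y mulmxBr mul_mx_scalar.
  rewrite dotDr dotNr dotZr -dotH yH dotZl -mulrBl nmulr_rge0 //.
  by rewrite subr_lt0 lt_neqAle eq_sym ab.
have := dot_ge0 (v *m H - a *: v); rewrite sqrE; have [ac'|ac'] := eqVneq a c.
  have : dot (v *m H - a *: v) (v *m H - a *: v) <= 0.
    by move: quad_le0; rewrite sqrE -ac'; lra.
  rewrite le_eqVlt ltNge dot_ge0 orbF dot_eq0 subr_eq0 => /eqP va _.
  by rewrite /qform va dotZl.
move=> sqa; suff : 0 <= (a - c) * (a * dot v v - s1).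
  by rewrite pmulr_rge0 ?subr_ge0 // subr_gt0 lt_neqAle eq_sym ac'.
by lra.
Qed.

End CubicCodim.

(** * The real and Hermitian blocks of the Hessian *)

Section Blocks.
Variable R : realType.
Implicit Types p q r c s : R.

Definition rows_mx n (l : seq (seq R)) : 'M[R]_n :=
  \matrix_(i, j) nth 0 (nth [::] l i) j.

Definition real_block p q r : 'M[R]_3 :=
  rows_mx 3 [:: [:: 0; r; q]; [:: r; 0; p]; [:: q; p; 0]].

Definition skew_block p q r : 'M[R]_3 :=
  rows_mx 3 [:: [:: 0; - r; q]; [:: r; 0; p]; [:: - q; - p; 0]].

(** Real form of a Hermitian matrix of size 3, hence the double eigenvalues. For [c^2 + s^2 = 1] the
    phases are placed so that the cyclic product of the off-diagonal entries has real part
    [- p q r c]. *)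
Definition hermitian_block p q r c s : 'M[R]_(3 + 3) :=
  block_mx (- c *: real_block p q r) (s *: skew_block p q r)
           (- s *: skew_block p q r) (- c *: real_block p q r).

Lemma real_block_sym p q r : (real_block p q r)^T = real_block p q r.
Proof.
by apply/matrixP => [[[|[|[|//]]] ?] [[|[|[|//]]] ?]]; rewrite !mxE /=.
Qed.

Lemma skew_block_tr p q r : (skew_block p q r)^T = - skew_block p q r.
Proof.
by apply/matrixP => [[[|[|[|//]]] ?] [[|[|[|//]]] ?]]; rewrite !mxE /=; ring.
Qed.

Lemma hermitian_block_sym p q r c s :
  (hermitian_block p q r c s)^T = hermitian_block p q r c s.
Proof.
rewrite tr_block_mx !linearZ /= real_block_sym skew_block_tr /hermitian_block.
by rewrite !scalerN !scaleNr opprK.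
Qed.

Lemma sum_inord n (F : 'I_n.+1 -> R) :
  \sum_i F i = \sum_(k <- iota 0 n.+1) F (inord k).
Proof.
transitivity (\sum_(0 <= k < n.+1) F (inord k)); last by rewrite /index_iota subn0.
by rewrite big_mkord; apply: eq_bigr => i _; rewrite inord_val.
Qed.

Let mulmx3E (A B : 'M[R]_3) i j : (A *m B) i j =
  A i (inord 0) * B (inord 0) j + A i (inord 1) * B (inord 1) j +
  A i (inord 2) * B (inord 2) j.
Proof. by rewrite mxE sum_inord !big_cons big_nil /= addr0 addrA. Qed.

Local Ltac entries3 :=
  apply/matrixP => [[[|[|[|//]]] ?] [[|[|[|//]]] ?]]; rewrite !(mulmx3E, mxE) ?inordK //=; ring.

Lemma real_block_sqr p q r : real_block p q r *m real_block p q r =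
  rows_mx 3 [:: [:: q ^+ 2 + r ^+ 2; p * q; p * r];
                [:: p * q; p ^+ 2 + r ^+ 2; q * r];
                [:: p * r; q * r; p ^+ 2 + q ^+ 2]].
Proof. entries3. Qed.

Lemma real_block_cubic p q r (A := real_block p q r) :
  A *m A *m A = (p ^+ 2 + q ^+ 2 + r ^+ 2) *: A + (2 * (p * q * r))%:M.
Proof. rewrite /A real_block_sqr; entries3. Qed.

Lemma real_block_trace p q r (A := real_block p q r) : \tr A = 0.
Proof. rewrite /mxtrace !(mxE, big_ord_recl, big_ord0) /=; ring. Qed.

Lemma real_block_trace2 p q r (A := real_block p q r) :
  \tr (A *m A) = 2 * (p ^+ 2 + q ^+ 2 + r ^+ 2).
Proof.
by rewrite /A real_block_sqr /mxtrace sum_inord !big_cons big_nil !mxE !inordK //=; ring.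
Qed.

Lemma skew_block_sqr p q r : skew_block p q r *m skew_block p q r =
  rows_mx 3 [:: [:: - (q ^+ 2 + r ^+ 2); - (p * q); - (p * r)];
                [:: - (p * q); - (p ^+ 2 + r ^+ 2); q * r];
                [:: - (p * r); q * r; - (p ^+ 2 + q ^+ 2)]].
Proof. entries3. Qed.

Lemma real_skew_comm p q r (A := real_block p q r) (B := skew_block p q r) :
  A *m B + B *m A = rows_mx 3 [:: [:: 0; 0; 0]; [:: 0; 0; 2 * (q * r)];
                                  [:: 0; - (2 * (q * r)); 0]].
Proof. entries3. Qed.

Lemma real_block_qform p q r (v : 'rV[R]_3) (x := v 0 (inord 0))
    (y := v 0 (inord 1)) (z := v 0 (inord 2)) :
  qform (real_block p q r) v = 2 * (r * (x * y) + q * (x * z) + p * (y * z)).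
Proof.
rewrite /qform /dot sum_inord /= !(big_cons, big_nil, mxE, sum_inord) /=.
by rewrite !(big_cons, big_nil, mxE, inordK) //= -/x -/y -/z; ring.
Qed.

Let hermitian_block_sqr p q r c s (A := real_block p q r) (B := skew_block p q r)
    (H := hermitian_block p q r c s) (N := c ^+ 2 *: (A *m A) - s ^+ 2 *: (B *m B))
    (L := - (c * s) *: (A *m B + B *m A)) : H *m H = block_mx N L (- L) N.
Proof.
rewrite /H /hermitian_block -/A -/B mulmx_block -!scalemxAl -!scalemxAr !scalerA.
rewrite /N /L scalerDr scaleNr !(mulrN, mulNr, scaleNr, opprK, opprD) -!expr2.
rewrite (mulrC s) (addrC (c ^+ 2 *: _)).
by rewrite [X in block_mx _ _ X]addrC [in X in block_mx _ _ _ X]addrC.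
Qed.

Lemma hermitian_block_cubic p q r c s (H := hermitian_block p q r c s) :
  H *m H *m H = ((c ^+ 2 + s ^+ 2) * (p ^+ 2 + q ^+ 2 + r ^+ 2)) *: H -
    (2 * (p * q * r) * c * (c ^+ 2 + s ^+ 2))%:M.
Proof.
rewrite hermitian_block_sqr real_block_sqr skew_block_sqr real_skew_comm.
rewrite /H mulmx_block scale_block_mx scalar_mx_block opp_block_mx add_block_mx.
by congr block_mx; entries3.
Qed.

Lemma hermitian_block_trace p q r c s (A := hermitian_block p q r c s) : \tr A = 0.
Proof. by rewrite mxtrace_block !mxtraceZ real_block_trace mulr0 addr0. Qed.

Lemma hermitian_block_trace2 p q r c s (A := hermitian_block p q r c s) :
  \tr (A *m A) = 4 * (c ^+ 2 + s ^+ 2) * (p ^+ 2 + q ^+ 2 + r ^+ 2).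
Proof.
rewrite hermitian_block_sqr mxtrace_block raddfB /= !mxtraceZ real_block_trace2.
rewrite skew_block_sqr [X in _ - s ^+ 2 * X]/mxtrace.
by rewrite sum_inord !big_cons big_nil !mxE !inordK //=; ring.
Qed.

(* In complex coordinates [z_i = g_i + i h_i] with [e = c + i s] this is
   [- 2 Re (r z_1 z_2^* e + q z_1 z_3^* e^* + p z_2 z_3^* e^* )]. *)
Lemma hermitian_block_qform p q r c s (g h : 'rV[R]_3)
    (g1 := g 0 (inord 0)) (g2 := g 0 (inord 1)) (g3 := g 0 (inord 2))
    (h1 := h 0 (inord 0)) (h2 := h 0 (inord 1)) (h3 := h 0 (inord 2)) :
  qform (hermitian_block p q r c s) (row_mx g h) =
  - 2 * (r * (c * (g1 * g2 + h1 * h2) - s * (h1 * g2 - g1 * h2)) +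
         q * (c * (g1 * g3 + h1 * h3) + s * (h1 * g3 - g1 * h3)) +
         p * (c * (g2 * g3 + h2 * h3) + s * (h2 * g3 - g2 * h3))).
Proof.
rewrite /qform mul_row_block dotE tr_row_mx mul_row_col mxE -!dotE /dot !sum_inord /=.
rewrite !(big_cons, big_nil, mxE, sum_inord) /=.
rewrite !(big_cons, big_nil, mxE, inordK) //=.
rewrite -/g1 -/g2 -/g3 -/h1 -/h2 -/h3; ring.
Qed.

End Blocks.

(** * Ordered roots of [T^3 - T + 2 m] *)

Section CubicRoots.
Variable R : realType.
Implicit Types m a b c : R.

Definition cubic_roots m a b c :=
  [/\ a + b + c = 0, a * b + b * c + c * a = -1, a * b * c = - (2 * m),
      c <= b & b <= a].

(** The critical points of the cubic are [- t] and [t], and the hypothesis says that it changes sign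
    between them, which traps the middle root [b]. The other two roots solve
    [T^2 + b T + b^2 - 1 = 0]. *)
Lemma cubic_roots_exist m : 27 * m ^+ 2 <= 1 -> exists a b c, cubic_roots m a b c.
Proof.
move=> m27; pose t : R := Num.sqrt 3^-1.
have t2 : t ^+ 2 = 3^-1 by rewrite sqr_sqrtr // invr_ge0.
have t0 : 0 <= t by exact: sqrtr_ge0.
have mt : `|3 * m| <= t.
  rewrite -(@ler_pXn2r _ 2) ?nnegrE // real_normK ?num_real // t2 exprMn.
  by move: m27; lra.
pose f : {poly R} := - 'X^3 + 'X - (2 * m)%:P.
have fE x : f.[x] = - x ^+ 3 + x - 2 * m by rewrite !hornerE.
have [b] : exists2 b, b \in `[- t, t] & root f b.
  apply: poly_ivt; first by lra.
  have t3 : t ^+ 3 = 3^-1 * t by rewrite exprSr t2.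
  rewrite !fE.
  have -> : (- t) ^+ 3 = - t ^+ 3 by ring.
  rewrite t3; move: mt; rewrite ler_norml; lra.
rewrite in_itv /= => /andP[tb bt] /rootP; rewrite fE => fb.
have b2 : b ^+ 2 <= 3^-1.
  by rewrite -t2; nra.
pose d := Num.sqrt (4 - 3 * b ^+ 2).
have d2 : d ^+ 2 = 4 - 3 * b ^+ 2 by rewrite sqr_sqrtr //; lra.
have d0 : 0 <= d by exact: sqrtr_ge0.
have bd : `|3 * b| <= d.
  by rewrite -(@ler_pXn2r _ 2) ?nnegrE // real_normK ?num_real // d2 exprMn; lra.
exists ((- b + d) / 2), b, ((- b - d) / 2).
move: bd; rewrite ler_norml => /andP[? ?]; split; [by field|by nra| |lra|lra].
by nra.
Qed.

Lemma cubic_roots_opp m a b c : cubic_roots m a b c -> cubic_roots (- m) (- c) (- b) (- a).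
Proof. by case=> *; split; lra. Qed.

Lemma cubic_roots_subst m a b c : cubic_roots m a b c ->
  c = - a - b /\ a ^+ 2 + a * b + b ^+ 2 = 1.
Proof.
case=> abc; have -> : c = - a - b by lra.
by move=> ? *; split=> //; lra.
Qed.

(** The nonnegative product [(a - b) (b - c)] is minus the derivative [3 T^2 - 1] of the cubic at
    [b]. *)
Lemma cubic_roots_mid m a b c : cubic_roots m a b c -> 3 * b ^+ 2 <= 1.
Proof.
move=> r; have [ce ab] := cubic_roots_subst r; case: r => _ _ _ cb ba.
have : 0 <= (a - b) * (b - c) by rewrite mulr_ge0 // subr_ge0.
by rewrite ce; lra.
Qed.

Lemma cubic_roots_top m a b c : cubic_roots m a b c -> 0 < a /\ 1 <= 3 * a ^+ 2.
Proof.
move=> r; have [ce ab] := cubic_roots_subst r; case: r => abc _ _ cb ba.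
have : 0 <= (a - b) * (a - c) by rewrite mulr_ge0 // subr_ge0 // (le_trans cb).
rewrite ce => h; have a2 : 1 <= 3 * a ^+ 2 by lra.
split=> //; rewrite lt_neqAle; apply/andP; split; last by lra.
by apply/eqP => a0; move: a2; rewrite -a0; lra.
Qed.

Lemma cubic_roots_midE m a b c : cubic_roots m a b c -> b ^+ 3 - b = - (2 * m).
Proof.
move=> r; have [ce ab] := cubic_roots_subst r; case: r => _ _ <- _ _.
rewrite ce; have -> : b ^+ 3 - b = b * (b ^+ 2 - 1) by ring.
by rewrite -ab; ring.
Qed.

Lemma cubic_roots_topE m a b c : cubic_roots m a b c -> a ^+ 3 - a = - (2 * m).
Proof.
move=> r; have [ce ab] := cubic_roots_subst r; case: r => _ _ <- _ _.
rewrite ce; have -> : a ^+ 3 - a = a * (a ^+ 2 - 1) by ring.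
by rewrite -ab; ring.
Qed.

(** The top roots lie beyond the last critical point, where [T^3 - T] increases; its value at them
    is [- 2 m]. *)
Lemma cubic_roots_top_anti m a b c m' a' b' c' :
  cubic_roots m a b c -> cubic_roots m' a' b' c' -> m <= m' -> a' <= a.
Proof.
move=> r r' mm'; have [a0 a2] := cubic_roots_top r; have [a0' a2'] := cubic_roots_top r'.
have := cubic_roots_topE r; have := cubic_roots_topE r'.
rewrite leNgt => e e'; apply/negP => aa'.
have : 0 < (a' - a) * (a ^+ 2 + a * a' + a' ^+ 2 - 1).
  rewrite mulr_gt0 ?subr_gt0 //; nra.
by lra.
Qed.

(** Subtracting the two equations multiplies [b' - b] by the factor [1 - (b^2 + b b' + b'^2)], which
    lies between 0 and 1 because both middle roots have square at most [1/3]. *)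
Lemma cubic_roots_mid_homo m a b c m' a' b' c' :
  cubic_roots m a b c -> cubic_roots m' a' b' c' -> m <= m' ->
  2 * (m' - m) <= b' - b.
Proof.
move=> r r' mm'; have b2 := cubic_roots_mid r; have b2' := cubic_roots_mid r'.
have := cubic_roots_midE r; have := cubic_roots_midE r' => e e'.
have e2 : (b' - b) * (1 - (b ^+ 2 + b * b' + b' ^+ 2)) = 2 * (m' - m) by lra.
have k0 : 0 <= 1 - (b ^+ 2 + b * b' + b' ^+ 2) by nra.
have k1 : 1 - (b ^+ 2 + b * b' + b' ^+ 2) <= 1 by nra.
have [bb'|bb'] := leP b b'; first by rewrite -e2; nra.
(* In the remaining case [b' < b] both sides must vanish, and under the bounds on the squares the
   factor is zero only when [b = b']. *)
have k0' : 0 <= (b - b') * (1 - (b ^+ 2 + b * b' + b' ^+ 2)) by rewrite mulr_ge0 // subr_ge0 ltW.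
have mm : m' = m by lra.
have /eqP : (b' - b) * (1 - (b ^+ 2 + b * b' + b' ^+ 2)) = 0 by rewrite e2 mm; ring.
rewrite mulf_eq0 subr_eq0 lt_eqF //= => /eqP k00.
have : (b - b') ^+ 2 <= 0 by lra.
by rewrite exprn_even_le0 //= subr_eq0 gt_eqF.
Qed.

End CubicRoots.

Section BlockCodim.
Variables (R : realType) (n k : nat) (H : 'M[R]_n) (m a b c : R).
Hypothesis Hsym : H^T = H.
Hypothesis nk : n = (3 * k)%N.
Hypothesis Hcubic : H *m H *m H = H - (2 * m)%:M.
Hypothesis trH : \tr H = 0.
Hypothesis trHH : \tr (H *m H) = (2 * k)%:R.
Hypothesis r : cubic_roots m a b c.

Let split_cubic : (H - a%:M) *m (H - b%:M) *m (H - c%:M) = 0.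
Proof.
have [e1 e2 e3 _ _] := r.
rewrite !(mulmxBl, mulmxBr) Hcubic !(mul_mx_scalar, mul_scalar_mx).
rewrite -!scalemxAl !mul_scalar_mx; apply/matrixP => i j; rewrite !mxE.
set S := \sum_j0 _; rewrite -[2 * m *+ _]mulr_natr -[a *+ _]mulr_natr.
move: (i == j)%:R => d.
transitivity (- (a + b + c) * S + (1 + (a * b + b * c + c * a)) * H i j -
              (2 * m + a * b * c) * d); first by ring.
by rewrite e1 e2 e3; ring.
Qed.

Let tr1 : \tr H = k%:R * (a + b + c).
Proof. by case: r => -> *; rewrite mulr0. Qed.

Let tr2 : \tr (H *m H) = k%:R * (a ^+ 2 + b ^+ 2 + c ^+ 2).
Proof.
have [-> e] := cubic_roots_subst r; rewrite trHH natrM mulrC; congr (_ * _).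
transitivity (2 * (a ^+ 2 + a * b + b ^+ 2)); first by rewrite e mulr1.
by ring.
Qed.

Let cb : c <= b. Proof. by case: r. Qed.
Let ba : b <= a. Proof. by case: r. Qed.

Lemma block_codim_mid : nonneg_codim k (fun v => qform H v - b * dot v v).
Proof. exact: (cubic_codim_mid Hsym nk split_cubic tr1 tr2 ba). Qed.

Lemma block_codim_top : nonneg_codim (2 * k) (fun v => qform H v - a * dot v v).
Proof. exact: (cubic_codim_top Hsym nk split_cubic tr1 tr2 cb ba). Qed.

Lemma block_le_top v : qform H v <= a * dot v v.
Proof. exact: (cubic_le_top Hsym split_cubic cb ba). Qed.

End BlockCodim.

(** * The cubic form in quaternionic coordinates *)

Section Quaternions.
Variable R : realType.
Implicit Types x y : quaternion R.

Definition qconj x := Quaternion (q0 x) (- q1 x) (- q2 x) (- q3 x).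
Definition qnorm2 x := q0 x ^+ 2 + q1 x ^+ 2 + q2 x ^+ 2 + q3 x ^+ 2.
Definition qscale (t : R) x := Quaternion (t * q0 x) (t * q1 x) (t * q2 x) (t * q3 x).
Definition qone : quaternion R := Quaternion 1 0 0 0.
Definition qcomplex (s t : R) := Quaternion s t 0 0.

Lemma qeqP x y :
  q0 x = q0 y -> q1 x = q1 y -> q2 x = q2 y -> q3 x = q3 y -> x = y.
Proof. by case: x y => [? ? ? ?] [? ? ? ?] /= -> -> -> ->. Qed.

Lemma qmul1 x : qmul x qone = x.
Proof. by apply: qeqP; rewrite /=; ring. Qed.

Lemma qone_mul x : qmul qone x = x.
Proof. by apply: qeqP; rewrite /=; ring. Qed.

Lemma qnorm2M x y : qnorm2 (qmul x y) = qnorm2 x * qnorm2 y.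
Proof. by rewrite /qnorm2 /=; ring. Qed.

Lemma qnorm2_conj x : qnorm2 (qconj x) = qnorm2 x.
Proof. by rewrite /qnorm2 /=; ring. Qed.

Lemma qnorm2_scale t x : qnorm2 (qscale t x) = t ^+ 2 * qnorm2 x.
Proof. by rewrite /qnorm2 /=; ring. Qed.

Lemma qnorm2_ge0 x : 0 <= qnorm2 x.
Proof. by rewrite /qnorm2 !addr_ge0 ?sqr_ge0. Qed.

Lemma qnorm2_eq0 x : qnorm2 x = 0 -> x = Quaternion 0 0 0 0.
Proof. by rewrite /qnorm2 => h; apply: qeqP => /=; nra. Qed.

Lemma qmul_conjl x : qnorm2 x = 1 -> qmul (qconj x) x = qone.
Proof. by move=> n1; apply: qeqP; rewrite /= -?n1 /qnorm2; ring. Qed.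

Lemma qmul_conjr x : qnorm2 x = 1 -> qmul x (qconj x) = qone.
Proof. by move=> n1; apply: qeqP; rewrite /= -?n1 /qnorm2; ring. Qed.

Lemma q0_mulC x y : q0 (qmul x y) = q0 (qmul y x).
Proof. by rewrite /=; ring. Qed.

Lemma qpolar x : exists p u, [/\ 0 <= p, qnorm2 u = 1 & x = qscale p u].
Proof.
have [x0|x0] := eqVneq (qnorm2 x) 0.
  exists 0, qone; split=> //; first by rewrite /qnorm2 /=; ring.
  by rewrite (qnorm2_eq0 x0); apply: qeqP => /=; ring.
pose p := Num.sqrt (qnorm2 x).
have p2 : p ^+ 2 = qnorm2 x by rewrite sqr_sqrtr // qnorm2_ge0.
have p0 : p != 0 by apply: contra_neq x0 => p0; rewrite -p2 p0 expr0n.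
exists p, (qscale p^-1 x); split; first exact: sqrtr_ge0.
  by rewrite qnorm2_scale -p2 -exprMn mulVf // expr1n.
by apply: qeqP; rewrite /= mulVKf.
Qed.

(** Half-angle formulas; the sign of [z1] is adjusted to that of [s]. *)
Lemma complex_sqrt (c s : R) : c ^+ 2 + s ^+ 2 = 1 ->
  exists z0 z1, [/\ z0 ^+ 2 + z1 ^+ 2 = 1, z0 ^+ 2 - z1 ^+ 2 = c & 2 * z0 * z1 = s].
Proof.
move=> cs; have c1 : -1 <= c <= 1 by apply/andP; split; nra.
pose z0 := Num.sqrt ((1 + c) / 2); pose z1 := Num.sqrt ((1 - c) / 2).
have e0 : z0 ^+ 2 = (1 + c) / 2 by rewrite sqr_sqrtr //; lra.
have e1 : z1 ^+ 2 = (1 - c) / 2 by rewrite sqr_sqrtr //; lra.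
have z00 : 0 <= z0 by exact: sqrtr_ge0.
have z10 : 0 <= z1 by exact: sqrtr_ge0.
have zz : (2 * z0 * z1) ^+ 2 = s ^+ 2 by rewrite !exprMn e0 e1; lra.
have /orP[/eqP h|/eqP h] : (2 * z0 * z1 == s) || (2 * z0 * z1 == - s) by rewrite -eqf_sqr zz.
  by exists z0, z1; split=> //; lra.
by exists z0, (- z1); split; rewrite ?sqrrN; lra.
Qed.

(* If the imaginary part of [n] has norm [t], the unit quaternion in the direction of
   [i t + Im n] conjugates [n] to [Re n + i t]; the sign is chosen to avoid cancellation. *)
Lemma qconj_complex n : qnorm2 n = 1 -> exists a c s,
  [/\ qnorm2 a = 1, c ^+ 2 + s ^+ 2 = 1 & qmul a n = qmul (qcomplex c s) a].
Proof.
move=> n1; pose t2 := q1 n ^+ 2 + q2 n ^+ 2 + q3 n ^+ 2.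
have t20 : 0 <= t2 by rewrite /t2 !addr_ge0 ?sqr_ge0.
have [t2e|t2e] := eqVneq t2 0.
  exists qone, (q0 n), 0.
  have e1 : q1 n = 0 by move: t2e; rewrite /t2; nra.
  have e2 : q2 n = 0 by move: t2e; rewrite /t2; nra.
  have e3 : q3 n = 0 by move: t2e; rewrite /t2; nra.
  split; first by rewrite /qnorm2 /=; ring.
    by rewrite -n1 /qnorm2 e1 e2 e3; ring.
  by apply: qeqP; rewrite /= ?e1 ?e2 ?e3; ring.
have [t [tt tn]] : exists t, t ^+ 2 = t2 /\ 0 <= t * q1 n.
  have e : Num.sqrt t2 ^+ 2 = t2 by rewrite sqr_sqrtr.
  have s0 : 0 <= Num.sqrt t2 by exact: sqrtr_ge0.
  have [h|h] := leP 0 (q1 n); first by exists (Num.sqrt t2); rewrite mulr_ge0.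
  by exists (- Num.sqrt t2); rewrite sqrrN mulNr -mulrN mulr_ge0 // oppr_ge0 ltW.
pose a' := Quaternion 0 (t + q1 n) (q2 n) (q3 n).
have [p [a [p0 a1 aE]]] := qpolar a'.
have pp : p ^+ 2 = 2 * t2 + 2 * (t * q1 n).
  transitivity (qnorm2 a'); first by rewrite aE qnorm2_scale a1 mulr1.
  by move: tt; rewrite /qnorm2 /= /t2; lra.
have p0' : p != 0.
  by apply: contra_neq t2e => p0'; move: pp; rewrite p0' expr0n /=; lra.
exists a, (q0 n), t; split=> //; first by rewrite tt -n1 /qnorm2 /t2; ring.
have e : qmul a' n = qmul (qcomplex (q0 n) t) a'.
  by apply: qeqP => /=; move: tt; rewrite /t2 => tt; first [ring | lra | nra].
have sl u v : qmul (qscale p u) v = qscale p (qmul u v) by apply: qeqP; rewrite /=; ring.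
have sr u v : qmul u (qscale p v) = qscale p (qmul u v) by apply: qeqP; rewrite /=; ring.
move: e; rewrite aE sl sr => -[] /(mulfI p0') ? /(mulfI p0') ? /(mulfI p0') ? /(mulfI p0') ?.
exact: qeqP.
Qed.

End Quaternions.

(** * Normal form of the cubic at a unit vector *)

Section NormalForm.
Variable R : realType.

Definition tri (x y z : 'rV[R]_12) : R :=
  q0 (qmul (qmul (qcomp x 0) (qcomp y 1)) (qcomp z 2)).

Definition cubicP (e : 'rV[R]_12) := tri e e e.
Definition cubic_grad (e v : 'rV[R]_12) := tri v e e + tri e v e + tri e e v.
Definition cubic_hess (e v : 'rV[R]_12) := 2 * (tri e v v + tri v e v + tri v v e).

Lemma dot_qcomp (v : 'rV[R]_12) :
  dot v v = qnorm2 (qcomp v 0) + qnorm2 (qcomp v 1) + qnorm2 (qcomp v 2).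
Proof. by rewrite /dot sum_inord !big_cons big_nil /qnorm2 /=; ring. Qed.

Definition sandwich (l r : quaternion R) k (v : 'rV[R]_12) :=
  qmul (qmul l (qcomp v k)) r.

Lemma sandwich_linear l r k t (u v : 'rV[R]_12)
    (x := sandwich l r k u) (y := sandwich l r k v) :
  sandwich l r k (t *: u + v) = Quaternion (t * q0 x + q0 y) (t * q1 x + q1 y)
    (t * q2 x + q2 y) (t * q3 x + q3 y).
Proof. by apply: qeqP; rewrite /x /y /= !mxE; ring. Qed.

Definition row3 (x y z : R) : 'rV[R]_3 := \row_k nth 0 [:: x; y; z] k.

Lemma row3_linear t x y z x' y' z' :
  row3 (t * x + x') (t * y + y') (t * z + z') = t *: row3 x y z + row3 x' y' z'.
Proof. by apply/rowP => -[[|[|[|//]]] ?]; rewrite !mxE. Qed.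

Lemma dot_row3 x y z : dot (row3 x y z) (row3 x y z) = x ^+ 2 + y ^+ 2 + z ^+ 2.
Proof.
by rewrite /dot sum_inord !big_cons big_nil /= !mxE !inordK //= addr0 !expr2 !addrA.
Qed.

Lemma dot_row_mx n p (u u' : 'rV[R]_n) (v v' : 'rV[R]_p) :
  dot (row_mx u v) (row_mx u' v') = dot u u' + dot v v'.
Proof. by rewrite !dotE tr_row_mx mul_row_col mxE. Qed.

(* Unit quaternions [a], [b], [c] with [q_1 = p a^-1 b], [q_2 = q b^-1 c] and
   [q_3 = r c^-1 z^2 a], [z] complex, turn the trilinear form at [e] into one with
   complex coefficients, where the complex and the [j]-components decouple. *)
Lemma cubic_normal_form (e : 'rV[R]_12) : dot e e = 1 ->
  exists p q r c s : R,
  [/\ [/\ 0 <= p, 0 <= q & 0 <= r], p ^+ 2 + q ^+ 2 + r ^+ 2 = 1,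
      c ^+ 2 + s ^+ 2 = 1, cubicP e = p * q * r * c &
  exists (fa fb : 'rV[R]_12 -> 'rV[R]_3) (fg : 'rV[R]_12 -> 'rV[R]_(3 + 3)),
  [/\ linear fa, linear fb, linear fg,
      forall v, dot v v = dot (fa v) (fa v) + dot (fb v) (fb v) + dot (fg v) (fg v) &
      forall v, cubic_hess e v = qform (real_block p q r) (fa v) -
        qform (real_block p q r) (fb v) + qform (hermitian_block p q r c s) (fg v)]].
Proof.
move=> ee; have [p [u [p0 u1 Xe]]] := qpolar (qcomp e 0).
have [q [u' [q0 u'1 Ye]]] := qpolar (qcomp e 1).
have [r [u'' [r0 u''1 Ze]]] := qpolar (qcomp e 2).
have [|a [c [s [a1 cs aN]]]] := @qconj_complex R (qmul (qmul u u') u'').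
  by rewrite !qnorm2M u1 u'1 u''1 !mulr1.
have [z0 [z1 [z01 zc zs]]] := complex_sqrt cs.
pose z := qcomplex z0 z1; pose z' := qcomplex z0 (- z1).
pose b := qmul a u; pose d := qmul b u'.
have b1 : qnorm2 b = 1 by rewrite qnorm2M a1 u1 mulr1.
have d1 : qnorm2 d = 1 by rewrite qnorm2M b1 u'1 mulr1.
have z'z : qmul z' z = qone R by apply: qeqP; rewrite /= -?z01; ring.
have zz' : qmul z z' = qone R by apply: qeqP; rewrite /= -?z01; ring.
have zz : qmul z z = qcomplex c s by rewrite -zc -zs; apply: qeqP; rewrite /=; ring.
have ka x : qmul (qconj a) (qmul a x) = x by rewrite qmulA qmul_conjl // qone_mul.
have kb x : qmul (qconj b) (qmul b x) = x by rewrite qmulA qmul_conjl // qone_mul.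
have kd x : qmul (qconj d) (qmul d x) = x by rewrite qmulA qmul_conjl // qone_mul.
have kz x : qmul z' (qmul z x) = x by rewrite qmulA z'z qone_mul.
have kz' x : qmul z (qmul z' x) = x by rewrite qmulA zz' qone_mul.
have uE : u = qmul (qconj a) b by rewrite ka.
have u'E : u' = qmul (qconj b) d by rewrite kb.
have u''E : u'' = qmul (qconj d) (qmul z (qmul z a)).
  by rewrite (qmulA z) zz -aN -[LHS]kd /d /b -!qmulA.
clearbody d; clearbody b.
have tri_scale (p' q' r' : R) x y w :
    Defs.q0 (qmul (qmul (qscale p' x) (qscale q' y)) (qscale r' w)) = p' * q' * r' * Defs.q0 (qmul (qmul x y) w) by rewrite /=; ring.
exists p, q, r, c, s; split=> //.
- rewrite -ee dot_qcomp Xe Ye Ze !qnorm2_scale u1 u'1 u''1; lra.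
- rewrite /cubicP /tri Xe Ye Ze tri_scale; congr (_ * _).
  by rewrite -[qmul (qmul u u') u'']ka aN q0_mulC -qmulA qmul_conjr // qmul1.
(* [z] is placed so that the mixed products below involve only conjugations by [z]. These fix the
   complex part of a quaternion and multiply its [j]-part by [c + i s] or by its conjugate. *)
pose y1 := sandwich (qmul z a) (qconj b) 0.
pose y2 := sandwich (qmul z b) (qconj d) 1.
pose y3 := sandwich (qmul z' d) (qconj a) 2.
(* Real parts, [i]-parts, and the [j]- and [k]-parts together. The real part of a product of complex
   numbers explains the minus sign of the second block. *)
exists (fun v => row3 (Defs.q0 (y1 v)) (Defs.q0 (y2 v)) (Defs.q0 (y3 v))).
exists (fun v => row3 (q1 (y1 v)) (q1 (y2 v)) (q1 (y3 v))).
exists (fun v => row_mx (row3 (q2 (y1 v)) (q2 (y2 v)) (q2 (y3 v)))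
                        (row3 (q3 (y1 v)) (q3 (y2 v)) (q3 (y3 v)))).
split.
- by move=> t v v'; rewrite /y1 /y2 /y3 !sandwich_linear /= row3_linear.
- by move=> t v v'; rewrite /y1 /y2 /y3 !sandwich_linear /= row3_linear.
- move=> t v v'; rewrite /y1 /y2 /y3 !sandwich_linear /= !row3_linear.
  by rewrite scale_row_mx add_row_mx.
- move=> v; rewrite dot_row_mx !dot_row3 dot_qcomp.
  have nz : qnorm2 z = 1 by rewrite -z01 /qnorm2 /=; ring.
  have nz' : qnorm2 z' = 1 by rewrite -z01 /qnorm2 /=; ring.
  have n1 : qnorm2 (y1 v) = qnorm2 (qcomp v 0).
    by rewrite !qnorm2M qnorm2_conj nz a1 b1 !mul1r mulr1.
  have n2 : qnorm2 (y2 v) = qnorm2 (qcomp v 1).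
    by rewrite !qnorm2M qnorm2_conj nz b1 d1 !mul1r mulr1.
  have n3 : qnorm2 (y3 v) = qnorm2 (qcomp v 2).
    by rewrite !qnorm2M qnorm2_conj nz' d1 a1 !mul1r mulr1.
  by rewrite -n1 -n2 -n3 /qnorm2; ring.
- move=> v.
  have e1 : Defs.q0 (qmul (qmul u (qcomp v 1)) (qcomp v 2)) =
      Defs.q0 (qmul z' (qmul (y2 v) (qmul z (y3 v)))).
    rewrite /y2 /y3 /sandwich -!qmulA kz kz' kd q0_mulC.
    by rewrite [RHS]q0_mulC -!qmulA -uE.
  have e2 : Defs.q0 (qmul (qmul (qcomp v 0) u') (qcomp v 2)) =
      Defs.q0 (qmul (y1 v) (qmul z (qmul (y3 v) z'))).
    rewrite /y1 /y3 /sandwich -!qmulA kz' [RHS]q0_mulC -!qmulA z'z qmul1.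
    by rewrite [RHS]q0_mulC -!qmulA qmul_conjl // qmul1 u'E -!qmulA.
  have e3 : Defs.q0 (qmul (qmul (qcomp v 0) (qcomp v 1)) u'') =
      Defs.q0 (qmul (y1 v) (qmul z' (qmul (y2 v) z))).
    rewrite /y1 /y2 /sandwich -!qmulA kz kb [RHS]q0_mulC -!qmulA.
    by rewrite [RHS]q0_mulC -!qmulA -u''E.
  have tri0 x y : tri e x y = p * Defs.q0 (qmul (qmul u (qcomp x 1)) (qcomp y 2)).
    by rewrite /tri Xe /=; ring.
  have tri1 x y : tri x e y = q * Defs.q0 (qmul (qmul (qcomp x 0) u') (qcomp y 2)).
    by rewrite /tri Ye /=; ring.
  have tri2 x y : tri x y e = r * Defs.q0 (qmul (qmul (qcomp x 0) (qcomp y 1)) u'').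
    by rewrite /tri Ze /=; ring.
  rewrite /cubic_hess tri0 tri1 tri2 e1 e2 e3 -zc -zs.
  move: (y1 v) (y2 v) (y3 v) => Y1 Y2 Y3.
  rewrite !real_block_qform hermitian_block_qform !mxE !inordK // /z /z' /=.
  (* The factor [z0^2 + z1^2 = 1] is inserted to make both sides homogeneous of degree two in [z0],
     [z1], as [ring] requires. *)
  transitivity ((z0 ^+ 2 + z1 ^+ 2) * 2 *
      (r * (Defs.q0 Y1 * Defs.q0 Y2 - q1 Y1 * q1 Y2) +
       q * (Defs.q0 Y1 * Defs.q0 Y3 - q1 Y1 * q1 Y3) +
       p * (Defs.q0 Y2 * Defs.q0 Y3 - q1 Y2 * q1 Y3)) - 2 *
      (r * ((z0 ^+ 2 - z1 ^+ 2) * (q2 Y1 * q2 Y2 + q3 Y1 * q3 Y2) -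
            2 * z0 * z1 * (q3 Y1 * q2 Y2 - q2 Y1 * q3 Y2)) +
       q * ((z0 ^+ 2 - z1 ^+ 2) * (q2 Y1 * q2 Y3 + q3 Y1 * q3 Y3) +
            2 * z0 * z1 * (q3 Y1 * q2 Y3 - q2 Y1 * q3 Y3)) +
       p * ((z0 ^+ 2 - z1 ^+ 2) * (q2 Y2 * q2 Y3 + q3 Y2 * q3 Y3) +
            2 * z0 * z1 * (q3 Y2 * q2 Y3 - q2 Y2 * q3 Y3)))).
    by ring.
  by rewrite z01; ring.
Qed.

End NormalForm.

Section HessianCodim.
Variable R : realType.
Implicit Types e u v x y z : 'rV[R]_12.

Lemma tri_linear1 t x x' y z : tri (t *: x + x') y z = t * tri x y z + tri x' y z.
Proof. by rewrite /tri /= !mxE; ring. Qed.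

Lemma tri_linear2 t x y y' z : tri x (t *: y + y') z = t * tri x y z + tri x y' z.
Proof. by rewrite /tri /= !mxE; ring. Qed.

Lemma tri_linear3 t x y z z' : tri x y (t *: z + z') = t * tri x y z + tri x y z'.
Proof. by rewrite /tri /= !mxE; ring. Qed.

Definition tri_linear := (tri_linear1, tri_linear2, tri_linear3).

Lemma triN1 x y z : tri (- x) y z = - tri x y z.
Proof. by rewrite /tri /= !mxE; ring. Qed.

Lemma triN2 x y z : tri x (- y) z = - tri x y z.
Proof. by rewrite /tri /= !mxE; ring. Qed.

Lemma triN3 x y z : tri x y (- z) = - tri x y z.
Proof. by rewrite /tri /= !mxE; ring. Qed.

Definition triN := (triN1, triN2, triN3).

Lemma triZ x y z t : (tri (t *: x) y z = t * tri x y z) *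
  (tri x (t *: y) z = t * tri x y z) * (tri x y (t *: z) = t * tri x y z).
Proof. by rewrite /tri /= !mxE; do !split; ring. Qed.

Lemma cubicP0 : cubicP (0 : 'rV[R]_12) = 0.
Proof. by rewrite /cubicP /tri /= !mxE; ring. Qed.

Lemma cubicPN e : cubicP (- e) = - cubicP e.
Proof. by rewrite /cubicP !triN; ring. Qed.

Lemma cubic_hessN e v : cubic_hess (- e) v = - cubic_hess e v.
Proof. by rewrite /cubic_hess !triN; ring. Qed.

Lemma amgm3 (p q r : R) : p ^+ 2 + q ^+ 2 + r ^+ 2 = 1 -> 27 * (p * q * r) ^+ 2 <= 1.
Proof.
move=> pqr; rewrite !exprMn; move: (sqr_ge0 p) (sqr_ge0 q) (sqr_ge0 r) pqr.
move: (p ^+ 2) (q ^+ 2) (r ^+ 2) => x y z x0 y0 z0 xyz.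
have h1 : 0 <= (x + y + z) * ((x - y) ^+ 2 + (y - z) ^+ 2 + (z - x) ^+ 2).
  by rewrite mulr_ge0 ?addr_ge0 ?sqr_ge0.
have h2 : 0 <= x * (y - z) ^+ 2 + y * (z - x) ^+ 2 + z * (x - y) ^+ 2.
  by rewrite !addr_ge0 // mulr_ge0 ?sqr_ge0.
have : 27 * (x * y * z) <= (x + y + z) ^+ 3 by lra.
by rewrite xyz expr1n.
Qed.

Lemma cubicP_sqr_le e : dot e e = 1 -> 27 * cubicP e ^+ 2 <= 1.
Proof.
move=> e1; have [p [q [r [c [c' [_ pqr cc -> _]]]]]] := cubic_normal_form e1.
have := amgm3 pqr; rewrite [(_ * c) ^+ 2]exprMn => h.
have : (p * q * r) ^+ 2 * c ^+ 2 <= (p * q * r) ^+ 2.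
  by rewrite ler_piMr ?sqr_ge0 //; have := sqr_ge0 c'; lra.
by lra.
Qed.

Lemma cubicP_roots e : dot e e = 1 -> exists a b c, cubic_roots (cubicP e) a b c.
Proof. by move=> /cubicP_sqr_le; exact: cubic_roots_exist. Qed.

(** With [a1 >= b1 >= c1] the roots for [M], monotonicity in [m] gives [a1 <= a <= - c1] and
    [b <= b1]. The codimensions count, block by block, the eigenvalues that violate the bound. *)
Lemma cubic_hess_codim e a b c : dot e e = 1 -> cubic_roots (cubicP e) a b c ->
  [/\ nonneg_codim 5 (fun v => cubic_hess e v - b * dot v v),
      nonneg_codim 9 (fun v => cubic_hess e v - a * dot v v) &
      nonneg_codim 1 (fun v => a * dot v v - cubic_hess e v)].
Proof.
move=> /cubic_normal_form[p [q [r [s [s' [[p0 q0 r0] pqr ss Pe]]]]]].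
move=> [fa [fb [fg [fal fbl fgl dE hE]]]] rt.
set M := p * q * r.
have M0 : 0 <= M by rewrite !mulr_ge0.
have s1 : -1 <= s <= 1 by apply/andP; split; nra.
have mM : cubicP e <= M by rewrite Pe -/M; nra.
have MN : - M <= cubicP e by rewrite Pe -/M; nra.
have [a1 [b1 [c1 rt1]]] := cubic_roots_exist (amgm3 pqr).
have rt1' := cubic_roots_opp rt1.
pose A := real_block p q r; pose H := hermitian_block p q r s s'.
have As : A^T = A := real_block_sym p q r.
have A3 : A *m A *m A = A - (2 * - M)%:M.
  by rewrite real_block_cubic pqr scale1r mulrN raddfN opprK.
have trA : \tr A = 0 := real_block_trace p q r.
have trAA : \tr (A *m A) = (2 * 1)%:R by rewrite real_block_trace2 pqr mulr1.
have qN (v : 'rV[R]_3) : qform (- A) v = - qform A v by rewrite /qform mulmxN dotNl.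
have NAs : (- A)^T = - A by rewrite raddfN /= As.
have NA3 : (- A) *m (- A) *m (- A) = - A - (2 * M)%:M.
  by rewrite !(mulNmx, mulmxN) !opprK A3 mulrN raddfN /= opprK opprD.
have trNA : \tr (- A) = 0 by rewrite raddfN /= trA oppr0.
have trNAA : \tr ((- A) *m (- A)) = (2 * 1)%:R by rewrite mulNmx mulmxN opprK.
have Hs : H^T = H := hermitian_block_sym p q r s s'.
have H3 : H *m H *m H = H - (2 * cubicP e)%:M.
  by rewrite hermitian_block_cubic pqr ss mulr1 scale1r Pe !mulr1 !mulrA.
have trH : \tr H = 0 := hermitian_block_trace p q r s s'.
have trHH : \tr (H *m H) = (2 * 2)%:R by rewrite hermitian_block_trace2 pqr ss !mulr1.
have aa1 : a <= - c1 by apply: cubic_roots_top_anti rt1' rt MN.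
have a1a : a1 <= a by apply: cubic_roots_top_anti rt rt1 mM.
have bb1 : b <= b1 by have := cubic_roots_mid_homo rt rt1 mM; rewrite -/M; lra.
have [a0 a2] := cubic_roots_top rt; have b2 := cubic_roots_mid rt.
have ba : b <= a by case: rt.
have b1a1 : b1 <= a1 by case: rt1.
have d0 n (v : 'rV[R]_n) := dot_ge0 v.
have b1a : - a <= b1.
  have := cubic_roots_mid rt1 => b12; rewrite leNgt; apply/negP => h.
  have : 0 < (- b1 - a) * (- b1 + a) by rewrite mulr_gt0; lra.
  by lra.
have kA_top : nonneg_codim 2 (fun v : 'rV[R]_3 => qform A v - (- c1) * dot v v).
  exact: (block_codim_top (k := 1) As erefl A3 trA trAA rt1').
have kNA_mid : nonneg_codim 1 (fun v : 'rV[R]_3 => qform (- A) v - b1 * dot v v).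
  exact: (block_codim_mid (k := 1) NAs erefl NA3 trNA trNAA rt1).
have kH_mid : nonneg_codim 2 (fun v : 'rV[R]_(3 + 3) => qform H v - b * dot v v).
  exact: (block_codim_mid (k := 2) Hs erefl H3 trH trHH rt).
have kH_top : nonneg_codim 4 (fun v : 'rV[R]_(3 + 3) => qform H v - a * dot v v).
  exact: (block_codim_top (k := 2) Hs erefl H3 trH trHH rt).
have H_le (v : 'rV[R]_(3 + 3)) : qform H v <= a * dot v v by exact: (block_le_top Hs H3 rt).
have NA_le (v : 'rV[R]_3) : qform (- A) v <= a1 * dot v v by exact: (block_le_top NAs NA3 rt1).
split.
(* 5 = 2 + 1 + 2: the part kept is [- c1] in the block [A], [a1] and [b1] in the block [- A], and
   [a] and [b] twice each in the Hermitian block. *)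
- have := nonneg_codimD (nonneg_codimD (nonneg_codim_comp fal kA_top)
    (nonneg_codim_comp fbl kNA_mid)) (nonneg_codim_comp fgl kH_mid).
  apply: nonneg_codim_le => v /=; rewrite qN dE hE.
  have h1 : 0 <= (- c1 - b) * dot (fa v) (fa v) by rewrite mulr_ge0 //; lra.
  have h2 : 0 <= (b1 - b) * dot (fb v) (fb v) by rewrite mulr_ge0 //; lra.
  by rewrite -/A -/H; lra.
(* 9 = 2 + 3 + 4: the block [- A], bounded above by [a1 <= a], is given up entirely. *)
- have kall : nonneg_codim 3 (fun v : 'rV[R]_3 => qform (- A) v - a * dot v v).
    by exists id => // v ->; rewrite /qform mul0mx !dot0l mulr0 subrr.
  have := nonneg_codimD (nonneg_codimD (nonneg_codim_comp fal kA_top)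
    (nonneg_codim_comp fbl kall)) (nonneg_codim_comp fgl kH_top).
  apply: nonneg_codim_le => v /=; rewrite qN dE hE.
  have h1 : 0 <= (- c1 - a) * dot (fa v) (fa v) by rewrite mulr_ge0 //; lra.
  by rewrite -/A -/H; lra.
(* Only [- c1] may exceed [a]. Asking [- A >= b1] removes it, since then [A <= - b1 <= a]. *)
- have := nonneg_codim_comp fal kNA_mid.
  apply: nonneg_codim_le => v /=; rewrite qN dE hE -/A -/H.
  have := H_le (fg v); have := NA_le (fb v); rewrite qN.
  have h1 : 0 <= (b1 + a) * dot (fa v) (fa v) by rewrite mulr_ge0 //; lra.
  have h2 : 0 <= (a - a1) * dot (fb v) (fb v) by rewrite mulr_ge0 //; lra.
  by lra.
Qed.

End HessianCodim.

(** * Separation of the Hessians of the solution *)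

Section SolutionHessian.
Variables (R : realType) (s : R).
Implicit Types e u v : 'rV[R]_12.

(** Second derivative of [P / |x|^s] at the unit vector [e] in the direction [v]. *)
Definition sol_hess e v := cubic_hess e v - 2 * s * dot e v * cubic_grad e v -
  s * cubicP e * dot v v + s * (s + 2) * cubicP e * dot e v ^+ 2.

Lemma sol_hessN e v : sol_hess (- e) v = - sol_hess e v.
Proof.
rewrite /sol_hess cubic_hessN cubicPN dotNl.
have -> : cubic_grad (- e) v = cubic_grad e v by rewrite /cubic_grad !triN; ring.
by ring.
Qed.

Lemma sol_hessZ e t v : sol_hess e (t *: v) = t ^+ 2 * sol_hess e v.
Proof.
by rewrite /sol_hess /cubic_hess /cubic_grad !triZ !(dotZl, dotZr); ring.
Qed.

Let shift e v := (- (s / 2 * dot e v)) *: e + v.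

(** By Euler's identities the Hessian of [P] at [e] pairs [e] with [v] to [2 cubic_grad e v], and
    [e] with itself to [6 cubicP e]. *)
Let sol_hess_shift e v : dot e e = 1 ->
  sol_hess e v + s * cubicP e * dot v v =
  cubic_hess e (shift e v) + cubicP e * dot e v ^+ 2 * (2 * (s - s ^+ 2 / 4)).
Proof.
move=> e1; rewrite /sol_hess /shift /cubic_hess !tri_linear /cubic_grad /cubicP.
by field.
Qed.

Let dot_shift e v : dot e e = 1 ->
  dot (shift e v) (shift e v) = dot v v - dot e v ^+ 2 * (s - s ^+ 2 / 4).
Proof.
by move=> e1; rewrite /shift !(dotDl, dotDr, dotZl, dotZr) e1 (dotC v e); field.
Qed.

Let shift_linear e : linear (shift e).
Proof.
move=> t u v; rewrite /shift dotDr dotZr scalerDr scalerA addrACA -scalerDl.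
by congr (_ *: _ + _); ring.
Qed.

Hypothesis s02 : 0 <= s <= 2.

(* On the preimage of a subspace under [v |-> v - (s/2) (e.v) e], completing the square
   absorbs the gradient terms of the Hessian of [P / |x|^s]. *)
Lemma sol_hess_upper k e T : dot e e = 1 -> 2 * cubicP e <= T ->
  nonneg_codim k (fun v => T * dot v v - cubic_hess e v) ->
  nonneg_codim k (fun v => (T - s * cubicP e) * dot v v - sol_hess e v).
Proof.
move=> e1 mT /(nonneg_codim_comp (shift_linear e)); apply: nonneg_codim_le => v /=.
have := sol_hess_shift v e1; rewrite dot_shift // => h.
(* This is the radial remainder of the completed square; its sign is the reason for requiring
   [2 * cubicP e <= T]. *)
have : 0 <= (T - 2 * cubicP e) * (dot e v ^+ 2 * (s - s ^+ 2 / 4)).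
  rewrite mulr_ge0 ?subr_ge0 // mulr_ge0 ?sqr_ge0 //.
  by case/andP: s02 => *; nra.
by lra.
Qed.

(** For a lower bound the radial remainder has the wrong sign unless [T <= 2 * cubicP e]. The
    hyperplane orthogonal to [e], where [shift] is the identity, avoids it at the cost of one
    dimension. *)
Lemma sol_hess_lower k e T : dot e e = 1 ->
  nonneg_codim k (fun v => cubic_hess e v - T * dot v v) ->
  nonneg_codim (k + 1) (fun v => sol_hess e v - (T - s * cubicP e) * dot v v).
Proof.
move=> e1 hk.
have he : nonneg_codim 1 (fun v => - dot e v ^+ 2).
  exists (fun v => \row_(i < 1) dot e v) => [t u v|v /rowP/(_ 0)].
    by apply/rowP => i; rewrite !mxE dotDr dotZr.
  by rewrite !mxE => ->; rewrite expr0n oppr0.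
have [L _ hL] := nonneg_codim_meet hk he.
apply: (nonneg_codim_mx (L := L)) => v /hL[h].
rewrite oppr_ge0 => h0; have /eqP : dot e v ^+ 2 == 0 by rewrite eq_le h0 sqr_ge0.
move/eqP; rewrite sqrf_eq0 => /eqP ev.
have := sol_hess_shift v e1; rewrite /shift ev mulr0 oppr0 scale0r add0r expr0n mulr0 mul0r addr0.
by lra.
Qed.

Lemma sol_hess_compare k k' e e' (O O' : 'M[R]_12) (t t' x y : R) :
  (k + k' < 12)%N -> O *m O^T = 1%:M -> O' *m O'^T = 1%:M -> 0 <= t -> 0 <= t' ->
  nonneg_codim k (fun v => sol_hess e v - x * dot v v) ->
  nonneg_codim k' (fun v => y * dot v v - sol_hess e' v) ->
  exists2 v, dot v v = 1 &
    t * x - t' * y <= t * sol_hess e (v *m O) - t' * sol_hess e' (v *m O').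
Proof.
move=> kk OO OO' t0 t0' hk hk'.
have lin (M : 'M[R]_12) : linear (fun v => v *m M).
  by move=> a u v; rewrite mulmxDl scalemxAl.
have dotO (M : 'M[R]_12) v : M *m M^T = 1%:M -> dot (v *m M) (v *m M) = dot v v.
  by move=> MM; rewrite dot_mulmxl -mulmxA MM mulmx1.
have [v v0 /= [h h']] := nonneg_codim_exists kk (nonneg_codim_comp (lin O) hk)
  (nonneg_codim_comp (lin O') hk').
have vv : 0 < dot v v by rewrite dot_gt0.
exists ((enorm v)^-1 *: v); first exact: dot_normalize.
rewrite -!scalemxAl !sol_hessZ exprVn sqr_enorm.
move: h h'; rewrite !dotO // => h h'.
have d0 : dot v v != 0 by rewrite gt_eqF.
have -> : t * ((dot v v)^-1 * sol_hess e (v *m O)) - t' * ((dot v v)^-1 * sol_hess e' (v *m O'))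
  = (t * sol_hess e (v *m O) - t' * sol_hess e' (v *m O')) / dot v v by field.
rewrite ler_pdivlMr // mulrBl.
have := mulr_ge0 t0 h; have := mulr_ge0 t0' h'; lra.
Qed.

End SolutionHessian.

(** * Trace of the Hessian in an orthonormal frame *)

Section Trace.
Variable R : realType.

Definition bilin n (b : 'rV[R]_n -> 'rV[R]_n -> R) : Prop :=
  (forall t u u' v, b (t *: u + u') v = t * b u v + b u' v) /\
  (forall t u v v', b u (t *: v + v') = t * b u v + b u v').

Lemma linear_sumE n (f : 'rV[R]_n -> R) :
  (forall t u v, f (t *: u + v) = t * f u + f v) ->
  forall v, f v = \sum_i v 0 i * f (delta_mx 0 i).
Proof.
move=> fl v; have f0 : f 0 = 0 by have := fl (-1) 0 0; rewrite scaler0 addr0 mulN1r addNr.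
rewrite {1}[v]row_sum_delta; elim/big_rec2: _ => [//|i y x _ <-].
by rewrite fl.
Qed.

Lemma bilinE n (b : 'rV[R]_n -> 'rV[R]_n -> R) : bilin b -> forall u v,
  b u v = dot (u *m \matrix_(i, j) b (delta_mx 0 i) (delta_mx 0 j)) v.
Proof.
move=> [bl br] u v; rewrite (linear_sumE (fun t x y => br t u x y)).
apply: eq_bigr => j _; rewrite mulrC (linear_sumE (fun t x y => bl t x y _)) !mxE.
by congr (_ * _); apply: eq_bigr => i _; rewrite mxE.
Qed.

Lemma trace_orthogonal n (b : 'rV[R]_n -> 'rV[R]_n -> R) (O : 'M[R]_n) :
  bilin b -> O *m O^T = 1%:M ->
  \sum_i b (delta_mx 0 i *m O) (delta_mx 0 i *m O) =
  \sum_i b (delta_mx 0 i) (delta_mx 0 i).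
Proof.
move=> bb OO; set B := \matrix_(i, j) b (delta_mx 0 i) (delta_mx 0 j).
transitivity (\tr (O *m B *m O^T)).
  apply: eq_bigr => i _; rewrite (bilinE bb) -/B -!rowE -row_mul [RHS]mxE.
  by apply: eq_bigr => j _; rewrite [row i _ 0 j]mxE [row i _ 0 j]mxE [(O^T)%R j i]mxE.
rewrite mxtrace_mulC mulmxA (mulmx1C OO) mul1mx.
by apply: eq_bigr => i _; rewrite mxE.
Qed.

(** A coordinate vector lives in one quaternionic factor, so a product that takes it in two factors
    vanishes. Thus [P] is harmonic. *)
Lemma tri_delta (e : 'rV[R]_12) i (d := delta_mx 0 i : 'rV[R]_12) :
  [/\ tri e d d = 0, tri d e d = 0 & tri d d e = 0].
Proof.
rewrite /d /tri /= !mxE !eqxx /= -!val_eqE /= !inordK //.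
clear d; by case: i => [[|[|[|[|[|[|[|[|[|[|[|[|//]]]]]]]]]]]] ?] /=; split; ring.
Qed.

(** As [P] is harmonic, the contributions are [- 2 s] times 3, [- s] times 12 and [s (s + 2)], each
    multiplied by [cubicP e]. *)
Lemma sol_hess_trace s (e : 'rV[R]_12) (O : 'M[R]_12) : dot e e = 1 ->
  O *m O^T = 1%:M ->
  \sum_i sol_hess s e (delta_mx 0 i *m O) = - (s * (16 - s) * cubicP e).
Proof.
move=> e1 OO.
have tr1 (b : 'rV[R]_12 -> 'rV[R]_12 -> R) : bilin b ->
    \sum_i b (delta_mx 0 i *m O) (delta_mx 0 i *m O) = \sum_i b (delta_mx 0 i) (delta_mx 0 i).
  by move=> bb; apply: trace_orthogonal.
pose b1 u v := tri e u v; pose b2 u v := tri u e v; pose b3 u v := tri u v e.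
have l1 : bilin b1 by split=> *; rewrite /b1 tri_linear.
have l2 : bilin b2 by split=> *; rewrite /b2 tri_linear.
have l3 : bilin b3 by split=> *; rewrite /b3 tri_linear.
pose b4 u v := dot e u * cubic_grad e v; pose b5 u v := dot e u * dot e v.
have l4 : bilin b4.
  by split=> *; rewrite /b4 /cubic_grad ?tri_linear ?dotDr ?dotZr; ring.
have l5 : bilin b5 by split=> *; rewrite /b5 ?dotDr ?dotZr; ring.
have l6 : bilin (@dot R 12).
  by split=> *; rewrite ?dotDr ?dotZr ?dotDl ?dotZl.
have dd (v : 'rV[R]_12) i : dot v (delta_mx 0 i) = v 0 i.
  by rewrite dotE trmx_delta -colE mxE.
have gl t u v : cubic_grad e (t *: u + v) = t * cubic_grad e u + cubic_grad e v.
  by rewrite /cubic_grad !tri_linear; ring.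
have s1 : \sum_i b1 (delta_mx 0 i) (delta_mx 0 i) = 0.
  by apply: big1 => i _; have [] := tri_delta e i.
have s2 : \sum_i b2 (delta_mx 0 i) (delta_mx 0 i) = 0.
  by apply: big1 => i _; have [] := tri_delta e i.
have s3 : \sum_i b3 (delta_mx 0 i) (delta_mx 0 i) = 0.
  by apply: big1 => i _; have [] := tri_delta e i.
have s4 : \sum_i b4 (delta_mx 0 i) (delta_mx 0 i) = 3 * cubicP e.
  transitivity (cubic_grad e e); last by rewrite /cubic_grad /cubicP; ring.
  by rewrite [RHS](linear_sumE gl); apply: eq_bigr => i _; rewrite /b4 dd.
have s5 : \sum_i b5 (delta_mx 0 i) (delta_mx 0 i) = 1.
  by rewrite -[RHS]e1; apply: eq_bigr => i _; rewrite /b5 !dd.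
have s6 : \sum_i dot (delta_mx 0 i : 'rV[R]_12) (delta_mx 0 i) = 12.
  under eq_bigr do rewrite dd mxE !eqxx /=.
  by rewrite sumr_const card_ord.
transitivity (2 * (\sum_i b1 (delta_mx 0 i *m O) (delta_mx 0 i *m O) +
    \sum_i b2 (delta_mx 0 i *m O) (delta_mx 0 i *m O) +
    \sum_i b3 (delta_mx 0 i *m O) (delta_mx 0 i *m O)) -
  2 * s * \sum_i b4 (delta_mx 0 i *m O) (delta_mx 0 i *m O) -
  s * cubicP e * \sum_i dot (delta_mx 0 i *m O) (delta_mx 0 i *m O) +
  s * (s + 2) * cubicP e * \sum_i b5 (delta_mx 0 i *m O) (delta_mx 0 i *m O)).
  rewrite -!big_split /= !mulr_sumr -!sumrN -!big_split /=; apply: eq_bigr => i _.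
  by rewrite /sol_hess /cubic_hess /b1 /b2 /b3 /b4 /b5; ring.
rewrite (tr1 b1) // (tr1 b2) // (tr1 b3) // (tr1 b4) // (tr1 b5) // (tr1 (@dot R 12)) //.
by rewrite s1 s2 s3 s4 s5 s6; ring.
Qed.

End Trace.

Section Comparison.
Variables (R : realType) (s : R).
Hypothesis s12 : 1 <= s < 2.
Implicit Types (e v : 'rV[R]_12) (O : 'M[R]_12).

Let s02 : 0 <= s <= 2.
Proof. by case/andP: s12 => *; apply/andP; split; lra. Qed.

(** Comparison with [m = 0], where the roots are 1, 0 and -1. *)
Lemma cubic_roots_mid_sign (m a b c : R) : cubic_roots m a b c ->
  (0 <= m -> 2 * m <= b) /\ (m <= 0 -> b <= 2 * m).
Proof.
have r0 : cubic_roots (0 : R) 1 0 (-1) by split; lra.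
move=> rt; split=> m0.
  by have := cubic_roots_mid_homo r0 rt m0; lra.
by have := cubic_roots_mid_homo rt r0 m0; lra.
Qed.

Lemma cubic_hess_codim_le_mid e a b c : dot e e = 1 -> cubic_roots (cubicP e) a b c ->
  nonneg_codim 5 (fun v => b * dot v v - cubic_hess e v).
Proof.
move=> e1 /cubic_roots_opp; rewrite -cubicPN => rt.
have e1' : dot (- e) (- e) = 1 by rewrite dotNl dotNr opprK.
have [+ _ _] := cubic_hess_codim e1' rt.
by apply: nonneg_codim_le => v; rewrite cubic_hessN; lra.
Qed.

Let lower k x e := nonneg_codim k (fun v => sol_hess s e v - x * dot v v).
Let upper k x e := nonneg_codim k (fun v => x * dot v v - sol_hess s e v).

Let upperN k x e : lower k x (- e) -> upper k (- x) e.
Proof. by apply: nonneg_codim_le => v; rewrite sol_hessN; lra. Qed.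

Let lowerN k x e : upper k x (- e) -> lower k (- x) e.
Proof. by apply: nonneg_codim_le => v; rewrite sol_hessN; lra. Qed.

(** In the required gap [2 - s], the [s] comes from the term [- s P |v|^2] of the Hessian and the 2
    from the growth of the roots. *)
Let separated e e' t t' := exists k k' x y, [/\ (k + k' < 12)%N, lower k x e,
  upper k' y e' & (2 - s) * (t * cubicP e - t' * cubicP e') <= t * x - t' * y].

Let separated_nonneg e e' t t' : dot e e = 1 -> dot e' e' = 1 ->
  0 <= t -> 0 <= t' -> 0 <= cubicP e -> 0 <= cubicP e' ->
  0 < t * cubicP e - t' * cubicP e' -> separated e e' t t'.
Proof.
move=> e1 e1' t0 t0' m0 m0' d0.
have [a [b [c rt]]] := cubicP_roots e1; have [a' [b' [c' rt']]] := cubicP_roots e1'.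
have [/(_ m0) bm _] := cubic_roots_mid_sign rt.
have [/(_ m0') bm' _] := cubic_roots_mid_sign rt'.
have [hmid htop _] := cubic_hess_codim e1 rt.
have [_ _ htop'] := cubic_hess_codim e1' rt'.
have hmid' := cubic_hess_codim_le_mid e1' rt'.
set m := cubicP e in rt bm m0 d0 *; set m' := cubicP e' in rt' bm' m0' d0 *.
have ba' : b' <= a' by case: rt'.
have [mm|mm] := leP m' m.
  exists 6, 5, (b - s * m), (b' - s * m'); split=> //.
  - exact: (sol_hess_lower s e1 hmid).
  - exact: (sol_hess_upper s02 e1' bm' hmid').
  have eb := cubic_roots_midE rt; have eb' := cubic_roots_midE rt'.
  rewrite -/m -/m'; suff : 2 * (t * m - t' * m') <= t * b - t' * b' by lra.
  have [m'0|m'0] := eqVneq m' 0.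
    have b'0 : b' = 0.
      have := cubic_roots_mid rt' => b2; move: eb'; rewrite m'0 mulr0 oppr0.
      have -> : b' ^+ 3 - b' = b' * (b' ^+ 2 - 1) by ring.
      by move/eqP; rewrite mulf_eq0 => /orP[/eqP//|/eqP h]; lra.
    rewrite m'0 b'0 !mulr0 !subr0 mulrCA; exact: ler_wpM2l.
  have m'p : 0 < m' by rewrite lt_neqAle eq_sym m'0.
  (* The ratio [b / m = 2 / (1 - b^2)] increases with [b]. Hence [t b - t' b'] is at least [b' / m']
     times [t m - t' m'], and [b' / m' >= 2]. *)
  have bb : b' * m <= b * m'.
    have bb' : b' <= b by have := cubic_roots_mid_homo rt' rt mm; lra.
    have : 0 <= b * b' * ((b - b') * (b + b')) by rewrite !mulr_ge0 //; lra.
    have q : b - b ^+ 3 = 2 * m by lra.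
    have q' : b' - b' ^+ 3 = 2 * m' by lra.
    have : 2 * (b * m' - b' * m) = b * (b' - b' ^+ 3) - b' * (b - b ^+ 3) by rewrite q q'; ring.
    by lra.
  rewrite -(ler_pM2l m'p).
  have h1 : t * (b' * m) <= t * (b * m') by exact: ler_wpM2l.
  have h2 : 0 <= (b' - 2 * m') * (t * m - t' * m') by rewrite mulr_ge0 //; lra.
  by lra.
(* Here [t' < t]: the middle roots may compare the wrong way, but the top root, which is at
   least [2 m'] and decreases with [m], profits from the larger scale. *)
exists 10, 1, (a - s * m), (a' - s * m'); split=> //.
- exact: (sol_hess_lower s e1 htop).
- by apply: (sol_hess_upper s02 e1' _ htop'); apply: le_trans bm' _.
rewrite -/m -/m'; have aa : a' <= a by apply: cubic_roots_top_anti rt rt' (ltW mm).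
have h1 : t * m <= t * m' by rewrite ler_wpM2l // ltW.
have h2 : t' <= t.
  rewrite leNgt; apply/negP => tt; have : t * m' <= t' * m' by rewrite ler_wpM2r // ltW.
  by lra.
have h3 : 0 <= (t - t') * (a' - 2 * m') by rewrite mulr_ge0 //; lra.
have h4 : t * a' <= t * a by exact: ler_wpM2l.
by lra.
Qed.

Let separated_sign e e' t t' : dot e e = 1 -> dot e' e' = 1 ->
  0 <= t -> 0 <= t' -> 0 <= cubicP e -> cubicP e' <= 0 -> separated e e' t t'.
Proof.
move=> e1 e1' t0 t0' m0 m0'.
have [a [b [c rt]]] := cubicP_roots e1; have [a' [b' [c' rt']]] := cubicP_roots e1'.
have [/(_ m0) bm _] := cubic_roots_mid_sign rt.
have [_ /(_ m0') bm'] := cubic_roots_mid_sign rt'.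
have [hmid _ _] := cubic_hess_codim e1 rt.
have hmid' := cubic_hess_codim_le_mid e1' rt'.
(* The level at [e'] is [2 * cubicP e'] instead of [b']: here [b' <= 2 * cubicP e'], and
   [sol_hess_upper] admits no smaller level. *)
exists 6, 5, (b - s * cubicP e), (2 * cubicP e' - s * cubicP e'); split=> //.
- exact: (sol_hess_lower s e1 hmid).
- apply: (sol_hess_upper s02 e1' (lexx _)); apply: nonneg_codim_le hmid' => v.
  have := dot_ge0 v => v0; rewrite lerB // ler_wpM2r //.
have : t * (2 * cubicP e) <= t * b by exact: ler_wpM2l.
by lra.
Qed.

Lemma sol_hess_separation e e' O O' (t t' : R) : dot e e = 1 -> dot e' e' = 1 ->
  O *m O^T = 1%:M -> O' *m O'^T = 1%:M -> 0 <= t -> 0 <= t' ->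
  0 < t * cubicP e - t' * cubicP e' ->
  exists2 v, dot v v = 1 & (2 - s) * (t * cubicP e - t' * cubicP e') <=
    t * sol_hess s e (v *m O) - t' * sol_hess s e' (v *m O').
Proof.
move=> e1 e1' OO OO' t0 t0' d0.
have N1 (x : 'rV[R]_12) : dot x x = 1 -> dot (- x) (- x) = 1.
  by rewrite dotNl dotNr opprK.
suff [k [k' [x [y [kk hx hy hxy]]]]] : separated e e' t t'.
  have [v v1 hv] := sol_hess_compare kk OO OO' t0 t0' hx hy.
  by exists v => //; apply: le_trans hv.
have [m0|m0] := leP 0 (cubicP e); have [m0'|m0'] := leP 0 (cubicP e').
- exact: separated_nonneg.
- by apply: separated_sign => //; exact: ltW.
- have h1 : t * cubicP e <= 0 by rewrite mulr_ge0_le0 // ltW.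
  have h2 : 0 <= t' * cubicP e' by rewrite mulr_ge0.
  by lra.
(* Both values are negative: passing to [- e] and [- e'] exchanges upper and lower bounds, and with
   them the roles of the two vectors. *)
- have dN : 0 < t' * cubicP (- e') - t * cubicP (- e) by rewrite !cubicPN; lra.
  have mN' : 0 <= cubicP (- e') by rewrite cubicPN oppr_ge0 ltW.
  have mN : 0 <= cubicP (- e) by rewrite cubicPN oppr_ge0 ltW.
  have [k [k' [x [y [kk hx hy hxy]]]]] :=
    separated_nonneg (N1 _ e1') (N1 _ e1) t0' t0 mN' mN dN.
  exists k', k, (- y), (- x); split; first by rewrite addnC.
  + exact: lowerN.
  + exact: upperN.
  by move: hxy; rewrite !cubicPN; lra.
Qed.

(** If [d > 0] the separation applies, and the coefficient is chosen to compensate the traces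
    exactly. If [d <= 0] the difference of the Hessians has nonnegative trace, hence a nonnegative
    diagonal entry. *)
Lemma sol_hess_pair e e' O (t t' : R) (T := fun e => - (s * (16 - s) * cubicP e)) :
  dot e e = 1 -> dot e' e' = 1 -> O *m O^T = 1%:M -> 0 <= t -> 0 <= t' ->
  exists2 v, dot v v = 1 & 0 <= (t * T e - t' * T e') +
    s * (16 - s) / (2 - s) * (t * sol_hess s e v - t' * sol_hess s e' (v *m O)).
Proof.
move=> e1 e1' OO t0 t0'; have /andP[s1 s2] := s12.
have I1 : (1%:M : 'M[R]_12) *m 1%:M^T = 1%:M by rewrite trmx1 mulmx1.
set d := t * cubicP e - t' * cubicP e'.
have -> : t * T e - t' * T e' = - (s * (16 - s) * d) by rewrite /T /d; ring.
have c0 : 0 < s * (16 - s) by rewrite mulr_gt0; lra.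
have c1 : 0 < (2 - s)^-1 by rewrite invr_gt0; lra.
have [d0|d0] := ltP 0 d.
  have [v v1] := sol_hess_separation e1 e1' I1 OO t0 t0' d0.
  rewrite mulmx1 -/d => hv; exists v => //.
  have -> : s * (16 - s) * d = s * (16 - s) / (2 - s) * ((2 - s) * d).
    by field; rewrite subr_eq0 gt_eqF.
  by rewrite addrC subr_ge0 ler_pM2l // mulr_gt0.
have [i hi] : exists i, 0 <= t * sol_hess s e (delta_mx 0 i) -
                        t' * sol_hess s e' (delta_mx 0 i *m O).
  apply/not_existsP => h.
  have : \sum_i (t * sol_hess s e (delta_mx 0 i *m 1%:M) -
                 t' * sol_hess s e' (delta_mx 0 i *m O)) < 0.
    rewrite big_ord_recl -[ltRHS]addr0 ltr_leD //.
      by rewrite mulmx1 ltNge; apply/negP/h.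
    by apply: sumr_le0 => i _; rewrite mulmx1 leNgt; apply/negP => /ltW; exact: h.
  rewrite big_split /= sumrN -!mulr_sumr !sol_hess_trace // ltNge => /negP; apply.
  have -> : t * - (s * (16 - s) * cubicP e) - t' * - (s * (16 - s) * cubicP e') =
    s * (16 - s) * (- d) by rewrite /d; ring.
  by rewrite mulr_ge0 ?oppr_ge0 // ltW.
exists (delta_mx 0 i); first exact: dot_delta.
apply: addr_ge0; last by rewrite mulr_ge0 // ltW // mulr_gt0.
by rewrite -mulrN mulr_ge0 ?oppr_ge0 // ltW.
Qed.

End Comparison.

Local Open Scope classical_set_scope.
Local Open Scope ring_scope.

(** * Derivatives along lines *)

Section LineDerivatives.
Variable R : realType.

Lemma is_derive_line (V : normedModType R) (f : V -> R) (x v : V) (t d : R) :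
  is_derive (x + t *: v) v f d -> is_derive t 1 (fun s => f (x + s *: v)) d.
Proof.
have E : (fun h : R => h^-1 *: ((f \o shift (x + t *: v)) (h *: v) - f (x + t *: v))) =
   (fun h : R => h^-1 *: (((fun s => f (x + s *: v)) \o shift t) (h *: 1) - f (x + t *: v))).
  apply/funext => h /=; congr (_ *: (f _ - _)).
  by rewrite [h *: 1]mulr1 scalerDl addrC -addrA [_ + h *: v]addrC.
case=> df dv; split; first by move: df; rewrite /derivable E.
by rewrite -dv /derive E.
Qed.

Lemma is_derive_lineP (V : normedModType R) (f : V -> R) (x v : V) (d : R) :
  is_derive x v f d <->
  (fun h : R => h^-1 *: (f (h *: v + x) - f x)) @ 0^' --> d.
Proof.
split=> [[df <-]|h]; first exact: df.
by split; [apply/cvg_ex; exists d|exact: cvg_lim].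
Qed.

(** The increment is split along [h w] and then along [h c e]; the mean value theorem turns the
    second part into a derivative at a nearby point. Adding coordinates one at a time, continuous
    partial derivatives give all directional derivatives. *)
Lemma is_derive_add_dir (V : normedModType R) (f : V -> R) (x w e : V) (c a : R) :
  is_derive x w f a -> (\forall y \near x, derivable f y e) ->
  {for x, continuous (fun y => derive f y e)} ->
  is_derive x (w + c *: e) f (a + c * derive f x e).
Proof.
move=> /is_derive_lineP fw fe cfe; apply/is_derive_lineP.
pose q1 (h : R) := h^-1 *: (f (h *: (w + c *: e) + x) - f (h *: w + x)).
have -> : (fun h : R => h^-1 *: (f (h *: (w + c *: e) + x) - f x)) =
    (fun h => h^-1 *: (f (h *: w + x) - f x)) \+ q1.
  by apply/funext => h /=; rewrite /q1 -scalerDr; congr (_ *: _); rewrite [RHS]addrC addrA subrK.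
apply: cvgD => //; apply/cvgrPdist_le => eps eps0.
have eps1 : 0 < eps / (`|c| + 1) by rewrite divr_gt0 // ltr_wpDl.
have /cvgrPdist_le/(_ _ eps1) nb := cfe.
have /nbhs_ballP[r /= r0 rb] : nbhs x [set y | derivable f y e /\
    `|derive f x e - derive f y e| <= eps / (`|c| + 1)].
  by apply: filterI fe nb.
(* For [|h| < r / K] the whole second segment stays in the ball where the estimate holds. *)
pose K := `|w| + `|c| * `|e| + 1.
have K0 : 0 < K by rewrite ltr_wpDl // addr_ge0 // mulr_ge0.
have rK : 0 < r / K by rewrite divr_gt0.
near=> h.
have h0 : h != 0 by near: h; exact: nbhs_dnbhs_neq.
have hK : `|h| < r / K by near: h; apply: dnbhs0_lt.
have inb (s : R) : 0 <= s <= 1 -> ball x r (h *: w + x + (s * (c * h)) *: e).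
  move=> /andP[s0 s1]; rewrite -ball_normE /= addrAC opprD addrCA subrr addr0 normrN.
  apply: (le_lt_trans (ler_normD _ _)).
  rewrite !normrZ (ger0_norm s0).
  have h1 : s * (`|c| * `|h|) * `|e| <= `|h| * (`|c| * `|e|).
    have -> : s * (`|c| * `|h|) * `|e| = s * (`|h| * (`|c| * `|e|)) by ring.
    by rewrite ler_piMl // !mulr_ge0.
  have h2 : `|h| * K < r by rewrite -ltr_pdivlMr.
  have h3 : 0 <= `|h| by [].
  by move: h2; rewrite /K; lra.
pose G (s : R) : R := f (h *: w + x + (s * (c * h)) *: e).
pose dG (s : R) : R := derive f (h *: w + x + (s * (c * h)) *: e) e * (c * h).
have dGE (s : R) : 0 <= s <= 1 -> is_derive s 1 G (dG s).
  move=> s01; rewrite /G /dG.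
  have [dfs _] := rb _ (inb s s01).
  apply: (@is_derive1_comp R (fun u => f (h *: w + x + u *: e)) (fun s => s * (c * h))).
    by apply/is_derive_line/derivableP.
  have -> : (fun s => s * (c * h)) = (c * h) \*: (@idfun R).
    by apply/funext => u /=; rewrite mulrC.
  by apply: is_derive_eq; rewrite [_ *: _]mulr1.
have [s s01 Gs] : exists2 s, s \in `[0, 1]%R & G 1 - G 0 = dG s * (1 - 0).
  apply: MVT_segment => //.
    by move=> s; rewrite in_itv /= => /andP[s0 s1]; apply: dGE; rewrite !ltW.
  apply: derivable_within_continuous => s; rewrite in_itv /= => s01.
  by have [] := dGE s s01.
have -> : q1 h = c * derive f (h *: w + x + (s * (c * h)) *: e) e.
  have -> : q1 h = h^-1 * (G 1 - G 0).
    have e1 : h *: (w + c *: e) + x = h *: w + x + (c * h) *: e.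
      by rewrite [h *: (_ + _)]scalerDr scalerA (mulrC c) addrAC.
    by rewrite /q1 e1 /G mul1r mul0r scale0r addr0.
  by rewrite Gs /dG subr0 mulr1; field.
rewrite -mulrBr normrM; move: (inb s); rewrite in_itv /= in s01 => /(_ s01)/rb[_ hd].
apply: le_trans (ler_wpM2l (normr_ge0 c) hd) _.
rewrite mulrCA -[leRHS]mulr1 ler_pM2l // ler_pdivrMr ?mul1r ?ler_wpDr //.
Unshelve. all: by end_near.
Qed.

Lemma is_derive_C1 n (x : 'rV[R]_n) (f : 'rV[R]_n -> R) (v : 'rV[R]_n) :
  C1_near x f -> is_derive x v f (\sum_i v 0 i * partial i f x).
Proof.
move=> c1; have [_ c1x] := nbhs_singleton c1.
rewrite {1}[v]row_sum_delta; elim/big_rec2: _ => [|i y w _ hy].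
  exact: is_derive0.
rewrite addrC [_ + y]addrC; apply: is_derive_add_dir => //.
  by apply: filterS c1 => y' [_ /(_ i)[]].
by have [_] := c1x i.
Qed.

Lemma C1_near_near n (x : 'rV[R]_n) (f : 'rV[R]_n -> R) :
  C1_near x f -> \forall y \near x, C1_near y f.
Proof. by move=> h; apply: nbhs_interior h. Qed.

Lemma near_line n (x v : 'rV[R]_n) (P : 'rV[R]_n -> Prop) :
  (\forall y \near x, P y) -> \forall t \near (0 : R), P (x + t *: v).
Proof.
move=> xP; have : (fun t : R => x + t *: v) @ (0 : R) --> x.
  rewrite -[in X in _ --> X](addr0 x) -[in X in _ --> X](scale0r v).
  by apply: cvgD; [exact: cvg_cst|apply: cvgZr_tmp; exact: cvg_id].
by move=> /(_ _ xP).
Qed.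

Lemma hessian_line n (x : 'rV[R]_n) (phi : 'rV[R]_n -> R) (v : 'rV[R]_n) :
  C2_near x phi -> exists g' : R -> R,
    (\forall t \near (0 : R), is_derive (t : R) 1 (fun u : R => phi (x + u *: v)) (g' t)) /\
    is_derive (0 : R) 1 g' (qform (hessian phi x) v).
Proof.
move=> [c1 c2]; exists (fun t => \sum_i v 0 i * partial i phi (x + t *: v)); split.
  apply: filterS (near_line v (C1_near_near c1)) => t ct.
  by apply/is_derive_line/is_derive_C1.
have -> : qform (hessian phi x) v =
    \sum_i v 0 i *: \sum_j v 0 j * partial j (partial i phi) x.
  rewrite /qform /dot; apply: eq_bigr => i _; rewrite mxE mulrC; congr (_ * _).
  by apply: eq_bigr => j _; rewrite mxE.
have -> : (fun t => \sum_i v 0 i * partial i phi (x + t *: v)) =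
    \sum_i (v 0 i \*: (fun t => partial i phi (x + t *: v))).
  by apply/funext => t; rewrite fct_sumE.
apply: is_derive_sum => i; apply: is_deriveZ.
apply: is_derive_line; rewrite scale0r addr0; exact: is_derive_C1.
Qed.

(** Were [c] negative, [f'], which vanishes at 0, would be negative just to the right of it, and the
    mean value theorem would produce a value below [f 0]. *)
Lemma second_derivative_min (f f' : R -> R) (c : R) :
  (\forall t \near (0 : R), is_derive (t : R) 1 f (f' t)) -> is_derive (0 : R) 1 f' c ->
  (\forall t \near (0 : R), f 0 <= f t) -> 0 <= c.
Proof.
move=> fd f'd fmin; rewrite leNgt; apply/negP => c0.
have /nbhs_ballP[r /= r0 rb] : nbhs (0 : R)
    [set t : R | is_derive t 1 f (f' t) /\ f 0 <= f t] by exact: filterI fd fmin.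
have inr (t : R) : `|t| < r -> is_derive t 1 f (f' t) /\ f 0 <= f t.
  by move=> tr; apply: rb; rewrite -ball_normE /= sub0r normrN.
have r2 : r / 2 < r by lra.
have inI (t : R) : t \in `](- (r / 2)), (r / 2)[ -> `|t| < r.
  by rewrite in_itv /= ltr_norml => /andP[? ?]; apply/andP; split; lra.
have f'0 : f' 0 = 0.
  have [|[_ <-] _] := inr 0 _; first by rewrite normr0.
  have [] := @derive1_at_min R f (- (r / 2)) (r / 2) 0 _ _ _ _ => //.
  - by lra.
  - by move=> t /inI/inr[[]].
  - by rewrite in_itv /=; apply/andP; split; lra.
  - by move=> t /inI/inr[].
move/is_derive_lineP: f'd; rewrite f'0 => /cvgrPdist_lt/(_ (- c)).
rewrite oppr_gt0 => /(_ c0)/nbhs_ballP[r' /= r'0 rb'].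
pose h := Num.min r r' / 2.
have m0 : 0 < Num.min r r' by rewrite lt_min r0.
have h0 : 0 < h by rewrite divr_gt0.
have [hr hr'] : h < r /\ h < r'.
  have : Num.min r r' <= r by rewrite ge_min lexx.
  have : Num.min r r' <= r' by rewrite ge_min lexx orbT.
  by rewrite /h; lra.
have inh (t : R) : 0 <= t <= h -> `|t| < r.
  by move=> /andP[t0 th]; rewrite ger0_norm //; lra.
have [||t] := @MVT R f f' 0 h h0.
- move=> t; rewrite in_itv /= => /andP[t0 th].
  by have [] := inr t _ => //; rewrite inh // !ltW.
- by apply: derivable_within_continuous => t; rewrite in_itv /= => /inh/inr[[]].
rewrite in_itv /= => /andP[t0 th] E.
have ft : f' t < 0.
  have : ball 0 r' t by rewrite -ball_normE /= sub0r normrN ger0_norm ?ltW // (lt_trans th).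
  move=> /rb' /= /(_ (lt0r_neq0 t0)); rewrite [t *: 1]mulr1 addr0 subr0 ltr_norml => /andP[+ _].
  rewrite opprK -subr_gt0 addrAC subrr sub0r oppr_gt0 => q.
  by rewrite -(pmulr_rlt0 _ (_ : 0 < t^-1)) // invr_gt0.
have [_ fh] : is_derive h 1 f (f' h) /\ f 0 <= f h by apply: inr; rewrite inh // lexx ltW.
have : f' t * (h - 0) < 0 by rewrite subr0 pmulr_llt0.
by rewrite -E; lra.
Qed.

End LineDerivatives.

(** * Second derivative of the solution along lines *)

Section Solution.
Variable R : realType.

Lemma w_deltaE (delta : R) (x : 'rV[R]_12) :
  w_delta delta x = cubicP x * dot x x `^ (- (1 + delta) / 2).
Proof.
rewrite /w_delta /w; have [->|x0] := eqVneq x 0.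
  by rewrite cubicP0 mul0r.
rewrite -/(tri x x x) -/(cubicP x) enorm_row.
have d0 : 0 < dot x x by rewrite dot_gt0.
rewrite -powR12_sqrt ?ltW // -powRrM -mulrA -!powRN -powRD; last first.
  by apply/implyP => _; rewrite gt_eqF.
by congr (_ * _ `^ _); field.
Qed.

(** The derivative is written as a sum of two functions of the same shape, polynomial times power of
    [q], so that the same lemma gives the second derivative. *)
Lemma is_derive_poly_powR (p q : {poly R}) (a t : R) : 0 < q.[t] ->
  is_derive t 1 (fun t => p.[t] * q.[t] `^ a)
    (p^`().[t] * q.[t] `^ a + (a *: (p * q^`())).[t] * q.[t] `^ (a - 1)).
Proof.
move=> qt.
have h : is_derive t 1 (fun t => q.[t] `^ a) (a * q.[t] `^ (a - 1) * q^`().[t]).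
  apply: (@is_derive1_comp R (fun u => u `^ a) (horner q)).
  exact: is_derive1_powR.
have -> : p^`().[t] * q.[t] `^ a + (a *: (p * q^`())).[t] * q.[t] `^ (a - 1) =
  p.[t] *: (a * q.[t] `^ (a - 1) * q^`().[t]) + (q.[t] `^ a) *: p^`().[t].
  by rewrite hornerZ hornerM /=; rewrite -![_ *: _]/(_ * _); ring.
exact: is_deriveM.
Qed.

Lemma is_derive2_poly_powR (p q : {poly R}) (a : R) (q0 := q.[0]) : 0 < q0 ->
  exists g' : R -> R,
  (\forall t \near (0 : R), is_derive (t : R) 1 (fun t : R => p.[t] * q.[t] `^ a) (g' t)) /\
  is_derive (0 : R) 1 g' (q0 `^ a * (p^`()^`().[0] + 2 * a * p^`().[0] * q^`().[0] / q0 +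
    a * p.[0] * (q^`()^`().[0] / q0 + (a - 1) * (q^`().[0] / q0) ^+ 2))).
Proof.
move=> q00.
exists (fun t => p^`().[t] * q.[t] `^ a + (a *: (p * q^`())).[t] * q.[t] `^ (a - 1)).
split.
  have qc := @continuous_horner R q 0.
  have : \forall t \near (0 : R), 0 < q.[t] by exact: (cvgr_gt _ qc).
  by apply: filterS => t; exact: is_derive_poly_powR.
have e1 : q0 `^ (a - 1) = q0 `^ a / q0.
  by rewrite powRB ?powRr1 ?ltW //; apply/implyP => _; rewrite gt_eqF.
have e2 : q0 `^ (a - 1 - 1) = q0 `^ a / q0 / q0.
  by rewrite powRB ?powRr1 ?ltW ?e1 //; apply/implyP => _; rewrite gt_eqF.
have n0 : q0 != 0 by rewrite gt_eqF.
apply: is_derive_eq; first by apply: is_deriveD; apply: is_derive_poly_powR.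
rewrite !(derivZ, derivM) !hornerE -/q0 e1 e2 /=.
by field.
Qed.

(** Along a line [P] and [|x|^2] are polynomials in [t]. The leading factor is [|x|^(1 - s)] with
    [s = 1 + delta], the homogeneity of the second derivatives. *)
Lemma w_delta_line (delta : R) (x v : 'rV[R]_12) : x != 0 ->
  exists g' : R -> R,
  (\forall t \near (0 : R), is_derive (t : R) 1 (fun t : R => w_delta delta (x + t *: v)) (g' t)) /\
  is_derive (0 : R) 1 g' (enorm x * dot x x `^ (- (1 + delta) / 2) *
    sol_hess (1 + delta) ((enorm x)^-1 *: x) v).
Proof.
move=> x0; set a := - (1 + delta) / 2.
have d0 : 0 < dot x x by rewrite dot_gt0.
pose p : {poly R} := (cubicP x)%:P + (cubic_grad x v)%:P * 'X +
  (cubic_hess x v / 2)%:P * 'X^2 + (cubicP v)%:P * 'X^3.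
pose q : {poly R} := (dot x x)%:P + (2 * dot x v)%:P * 'X + (dot v v)%:P * 'X^2.
have pE t : p.[t] = cubicP (x + t *: v).
  rewrite /p !hornerE /= (addrC x) /cubicP !tri_linear /cubic_grad /cubic_hess.
  by field.
have qE t : q.[t] = dot (x + t *: v) (x + t *: v).
  rewrite /q !hornerE /= !(dotDl, dotDr, dotZl, dotZr) (dotC v x); ring.
have q0E : q.[0] = dot x x by rewrite qE scale0r addr0.
have q0p : 0 < q.[0] by rewrite q0E.
have [g' [h1 h2]] := @is_derive2_poly_powR p q a q0p.
exists g'; split.
  apply: filterS h1 => t; congr is_derive.
  by apply/funext => u; rewrite w_deltaE pE qE.
apply: is_derive_eq h2 _; rewrite q0E.
have p0E : p.[0] = cubicP x by rewrite pE scale0r addr0.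
rewrite p0E.
have -> : p^`().[0] = cubic_grad x v.
  by rewrite /p !(derivD, derivM, derivC, derivXn, derivX) !hornerE /=; ring.
have -> : q^`().[0] = 2 * dot x v.
  by rewrite /q !(derivD, derivM, derivC, derivXn, derivX) !hornerE /=; ring.
have -> : p^`()^`().[0] = cubic_hess x v.
  by rewrite /p !(derivD, derivM, derivC, derivXn, derivX) !hornerE /=; field.
have -> : q^`()^`().[0] = 2 * dot v v.
  by rewrite /q !(derivD, derivM, derivC, derivXn, derivX) !hornerE /=; ring.
have l0 : enorm x != 0 by rewrite gt_eqF // enorm_gt0.
have l2 := sqr_enorm x; move: (enorm x) l0 l2 => l l0 l2.
rewrite /sol_hess.
have -> : cubic_hess (l^-1 *: x) v = cubic_hess x v / l.
  by rewrite /cubic_hess !triZ; ring.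
have -> : cubic_grad (l^-1 *: x) v = cubic_grad x v / l ^+ 2.
  by rewrite /cubic_grad !triZ; field.
have -> : cubicP (l^-1 *: x) = cubicP x / l ^+ 3.
  by rewrite /cubicP !triZ; field.
rewrite dotZl -l2 /a.
by field.
Qed.

End Solution.

(** * Continuity of the solution *)

Section Continuity.
Variable R : realType.

Section RealFunctions.
Variables (T : topologicalType) (f g : T -> R).
Hypotheses (fc : continuous f) (gc : continuous g).

Lemma continuous_fun_add : continuous (fun x => f x + g x).
Proof. by move=> x; apply: cvgD; [exact: fc|exact: gc]. Qed.

Lemma continuous_fun_opp : continuous (fun x => - f x).
Proof. by move=> x; apply: cvgN; exact: fc. Qed.

Lemma continuous_fun_mul : continuous (fun x => f x * g x).
Proof. by move=> x; apply: cvgM; [exact: fc|exact: gc]. Qed.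

End RealFunctions.

Local Ltac polynomial_continuous := match goal with
  | |- forall x, continuous_at x (fun y => @Algebra.add _ (@?f y) (@?g y)) =>
      apply: (@continuous_fun_add _ f g); polynomial_continuous
  | |- forall x, continuous_at x (fun y => @Algebra.opp _ (@?f y)) =>
      apply: (@continuous_fun_opp _ f); polynomial_continuous
  | |- forall x, continuous_at x (fun y => @GRing.mul _ (@?f y) (@?g y)) =>
      apply: (@continuous_fun_mul _ f g); polynomial_continuous
  | |- forall x, continuous_at x (fun y => @GRing.exp _ (@?f y) _) =>
      apply: (@continuous_fun_mul _ f f); polynomial_continuous
  | |- _ => exact: coord_continuous
  end.

Lemma cubicP_continuous : continuous (@cubicP R).
Proof.
suff : continuous (fun x : 'rV[R]_12 => tri x x x) by [].
rewrite /tri /qcomp /=.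
polynomial_continuous.
Qed.

Lemma dot_continuous : continuous (fun x : 'rV[R]_12 => dot x x).
Proof.
have -> : (fun x : 'rV[R]_12 => dot x x) =
    fun x => qnorm2 (qcomp x 0) + qnorm2 (qcomp x 1) + qnorm2 (qcomp x 2).
  by apply/funext => y; exact: dot_qcomp.
rewrite /qnorm2 /qcomp /=.
polynomial_continuous.
Qed.

Lemma cubicP_bound (x : 'rV[R]_12) : `|cubicP x| <= enorm x ^+ 3.
Proof.
have [->|x0] := eqVneq x 0; first by rewrite cubicP0 normr0 exprn_ge0 // sqrtr_ge0.
have h := cubicP_sqr_le (dot_normalize x0).
move: x0; rewrite -enorm_gt0; move: (enorm x) h => l h l0.
have -> : cubicP x = l ^+ 3 * cubicP (l^-1 *: x).
  by rewrite /cubicP !triZ; field; rewrite gt_eqF.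
have l3 : 0 <= l ^+ 3 by rewrite exprn_ge0 // ltW.
rewrite normrM ger0_norm // ler_piMr //.
rewrite -(@ler_pXn2r _ 2) ?nnegrE // real_normK ?num_real // expr1n.
by have := sqr_ge0 (cubicP (l^-1 *: x)); lra.
Qed.

Lemma w_delta_bound (delta : R) (x : 'rV[R]_12) : 0 <= delta < 1 -> enorm x <= 1 ->
  `|w_delta delta x| <= enorm x.
Proof.
move=> /andP[d0 d1]; have [->|x0] := eqVneq x 0.
  by rewrite /w_delta eqxx normr0 sqrtr_ge0.
rewrite w_deltaE normrM (ger0_norm (powR_ge0 _ _)) -sqr_enorm.
have := cubicP_bound x; move: x0; rewrite -enorm_gt0.
move: (enorm x) => l l0 xl l1; have l00 := ltW l0.
apply: le_trans (ler_wpM2r (powR_ge0 _ _) xl) _.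
(* The exponents add up to [2 - delta >= 1], whence the bound for [l <= 1]. *)
rewrite -!powR_mulrn // -powRrM -powRD; last by apply/implyP => _; rewrite gt_eqF.
rewrite -[leRHS]powRr1 //; apply: ger_powR; first by rewrite l0.
by lra.
Qed.

Lemma w_delta_continuous (delta : R) : 0 <= delta < 1 -> continuous (@w_delta R delta).
Proof.
move=> d01 x; rewrite /continuous_at.
have [->|x0] := eqVneq x 0; last first.
  set a := - (1 + delta) / 2.
  have wE : @w_delta R delta = fun y => cubicP y * dot y y `^ a.
    by apply/funext => y; exact: w_deltaE.
  rewrite wE.
  have dx0 : 0 < dot x x by rewrite dot_gt0.
  have powc : (fun y => dot y y `^ a) y @[y --> x] --> dot x x `^ a.
    apply: (@continuous_comp _ _ _ (fun y => dot y y) (fun u => u `^ a)).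
      exact: dot_continuous.
    apply/differentiable_continuous/derivable1_diffP.
    by have [] := is_derive1_powR a dx0.
  exact: cvgM (@cubicP_continuous x) powc.
have -> : w_delta delta (0 : 'rV[R]_12) = 0 by rewrite /w_delta eqxx.
suff : w_delta delta y @[y --> (0 : 'rV[R]_12)] --> (0 : R) by [].
have FF : Filter (nbhs (0 : 'rV[R]_12)) := nbhs_filter (0 : 'rV[R]_12).
apply/(@cvgrPdist_le R R _ _ FF) => eps eps0.
have ec : enorm y @[y --> (0 : 'rV[R]_12)] --> (0 : R).
  have -> : (fun y : 'rV[R]_12 => enorm y) = fun y => Num.sqrt (dot y y).
    by apply/funext => y; exact: enorm_row.
  have e0 : (0 : R) = Num.sqrt (dot (0 : 'rV[R]_12) 0) by rewrite dot0l sqrtr0.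
  rewrite [X in _ --> X]e0.
  apply: (@continuous_comp _ _ _ (fun y => dot y y) Num.sqrt).
    exact: dot_continuous.
  exact: sqrt_continuous.
have m0 : 0 < Num.min eps 1 by rewrite lt_min eps0 ltr01.
have := @cvgr_lt R _ _ FF _ _ ec _ m0.
apply: filterS => y; rewrite lt_min => /andP[ye y1].
by rewrite sub0r normrN; apply: le_trans (w_delta_bound d01 (ltW y1)) (ltW ye).
Qed.

End Continuity.

(** * The Hessian equation *)

Section MatrixBounds.
Variables (R : realType) (n : nat).
Implicit Types (M N : 'M[R]_n) (v : 'rV[R]_n).

Lemma enorm_ge0 m p (A : 'M[R]_(m, p)) : 0 <= enorm A.
Proof. exact: sqrtr_ge0. Qed.

Lemma enormN M : enorm (- M) = enorm M.
Proof.
by congr Num.sqrt; apply: eq_bigr => i _; apply: eq_bigr => j _; rewrite mxE sqrrN.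
Qed.

Lemma le_enorm M i j : `|M i j| <= enorm M.
Proof.
rewrite -sqrtr_sqr ler_wsqrtr // (bigD1 i) //= (bigD1 j) //= -addrA lerDl addr_ge0 //.
  by apply: sumr_ge0 => k _; exact: sqr_ge0.
by apply: sumr_ge0 => k _; apply: sumr_ge0 => l _; exact: sqr_ge0.
Qed.

Lemma mxtrace_le_enorm M : `|\tr M| <= n%:R * enorm M.
Proof.
apply: le_trans (ler_norm_sum _ _ _) _.
apply: le_trans (ler_sum _ (fun i _ => le_enorm M i i)) _.
by rewrite sumr_const card_ord mulr_natl.
Qed.

Lemma qform_le_enorm M v : dot v v = 1 -> `|qform M v| <= (n * n)%:R * enorm M.
Proof.
move=> v1; have vle i : `|v 0 i| <= 1.
  rewrite -(@ler_pXn2r _ 2) ?nnegrE // expr1n real_normK ?num_real // -v1 /dot (bigD1 i) //=.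
  by rewrite -expr2 lerDl sumr_ge0 // => j _; rewrite -expr2 sqr_ge0.
have h i j : `|v 0 i * M i j * v 0 j| <= enorm M.
  rewrite !normrM -[leRHS]mulr1; apply: ler_pM; rewrite ?mulr_ge0 //.
  by rewrite -[leRHS]mul1r; apply: ler_pM; rewrite ?le_enorm.
have -> : qform M v = \sum_j \sum_i v 0 i * M i j * v 0 j.
  by rewrite /qform /dot; apply: eq_bigr => j _; rewrite mxE mulr_suml.
apply: le_trans (ler_norm_sum _ _ _) _.
apply: (@le_trans _ _ (\sum_(j < n) n%:R * enorm M)).
  apply: ler_sum => j _; apply: le_trans (ler_norm_sum _ _ _) _.
  apply: le_trans (ler_sum _ (fun i _ => h i j)) _.
  by rewrite sumr_const card_ord mulr_natl.
by rewrite sumr_const card_ord -[leLHS]mulr_natl natrM mulrA.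
Qed.

Lemma qformD M N v : qform (M + N) v = qform M v + qform N v.
Proof. by rewrite /qform mulmxDr dotDl. Qed.

Lemma qformNmx M v : qform (- M) v = - qform M v.
Proof. by rewrite /qform mulmxN dotNl. Qed.

Lemma qform_delta M i : qform M (delta_mx 0 i) = M i i.
Proof. by rewrite /qform -rowE dotE trmx_delta -colE !mxE. Qed.

Lemma qform_congr (O S : 'M[R]_n) v : qform (O^T *m S *m O) v = qform S (v *m O^T).
Proof. by rewrite /qform !mulmxA dot_mulmxl. Qed.

(** Minors of size two give [N i j ^+ 2 <= N i i * N j j]; the sum of the right-hand sides is the
    square of the trace. *)
Lemma enorm_le_mxtrace N : nonneg_definite N -> enorm N <= \tr N.
Proof.
move=> [/symmetricmxP Ns Nv].
have q0 v : 0 <= qform N v by rewrite /qform dotE.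
have d0 i : 0 <= N i i by rewrite -qform_delta.
have t0 : 0 <= \tr N by apply: sumr_ge0.
have minor i j : N i j ^+ 2 <= N i i * N j j.
  have Nji : N j i = N i j by rewrite -{1}Ns mxE.
  have q2 (s t : R) : 0 <= s ^+ 2 * N i i + 2 * s * t * N i j + t ^+ 2 * N j j.
    have := q0 (s *: delta_mx 0 i + t *: delta_mx 0 j).
    rewrite /qform mulmxDl -!scalemxAl -!rowE !(dotDl, dotDr, dotZl, dotZr).
    rewrite !dotE !trmx_delta -!colE !mxE Nji.
    by move=> h; apply: le_trans h _; rewrite le_eqVlt; apply/orP; left; apply/eqP; ring.
  have [Nii|Nii] := eqVneq (N i i) 0; last first.
    have := q2 (- N i j) (N i i).
    have -> : (- N i j) ^+ 2 * N i i + 2 * - N i j * N i i * N i j + N i i ^+ 2 * N j j =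
      N i i * (N i i * N j j - N i j ^+ 2) by ring.
    by rewrite pmulr_rge0 ?subr_ge0 // lt_neqAle eq_sym Nii d0.
  have [Nij|Nij] := eqVneq (N i j) 0; first by rewrite Nij Nii expr0n mul0r.
  (* If [N i i = 0] and [N i j] were nonzero, the form would take the value -1 at this vector. *)
  have := q2 (- (N j j + 1) / (2 * N i j)) 1; rewrite Nii mulr0 add0r expr1n mul1r mulr1.
  have -> : 2 * (- (N j j + 1) / (2 * N i j)) * N i j + N j j = -1 by field.
  by rewrite oppr_ge0 ler10.
rewrite -(ger0_norm t0) -sqrtr_sqr ler_wsqrtr // expr2 {2}/mxtrace mulr_suml.
by apply: ler_sum => i _; rewrite mulr_sumr; apply: ler_sum => j _; exact: minor.
Qed.

End MatrixBounds.

Section Equation.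
Variables (R : realType) (s : R).
Hypothesis s12 : 1 <= s < 2.
Implicit Types (M N O : 'M[R]_12) (e v : 'rV[R]_12).

Let K := s * (16 - s) / (2 - s).

Let K0 : 0 <= K.
Proof. by case/andP: s12 => *; rewrite /K mulr_ge0 ?invr_ge0 ?mulr_ge0; lra. Qed.

Let T e := - (s * (16 - s) * cubicP e).

(* Upper bounds for [tr (M - A) + K lambda_max (M - A)], where [A] is the Hessian of the
   solution at a multiple of [e], rotated by [O]; [t = 0] puts [A = 0] into the family. *)
Definition eqn_values M : set R := [set c | exists t e O,
  [/\ 0 <= t, dot e e = 1, O *m O^T = 1%:M & forall v, dot v v = 1 ->
  \tr M - t * T e + K * (qform M v - t * sol_hess s e (v *m O)) <= c]].

Definition eqn M := inf (eqn_values M).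

Let Lip : R := 12%:R + K * (12 * 12)%:R.

Let Lip_ge1 : 1 <= Lip.
Proof. by have := K0; rewrite /Lip; lra. Qed.

Let affine_le M v : dot v v = 1 -> `|\tr M + K * qform M v| <= Lip * enorm M.
Proof.
move=> v1; apply: le_trans (ler_normD _ _) _; rewrite normrM (ger0_norm K0) /Lip.
have h1 := mxtrace_le_enorm M; have h2 := ler_wpM2l K0 (qform_le_enorm M v1).
by rewrite mulrDl -mulrA; apply: lerD.
Qed.

Let e0 : 'rV[R]_12 := delta_mx 0 0.

Let e01 : dot e0 e0 = 1.
Proof. exact: dot_delta. Qed.

Let I1 : (1%:M : 'M[R]_12) *m 1%:M^T = 1%:M.
Proof. by rewrite trmx1 mulmx1. Qed.

Let eqn_values_neq0 M : eqn_values M !=set0.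
Proof.
exists (Lip * enorm M), 0, e0, 1%:M; split=> // v v1.
rewrite !mul0r !subr0; apply: le_trans (ler_norm _) _; exact: affine_le.
Qed.

(** For each member of the family, [sol_hess_pair] supplies a direction [v] in which the expression
    bounded by [c] is nonnegative. *)
Let eqn_values_ge (t : R) e M c : 0 <= t -> dot e e = 1 -> t * T e <= \tr M ->
  (forall v, t * sol_hess s e v <= qform M v) -> eqn_values M c -> 0 <= c.
Proof.
move=> t0 e1 trM qM [t' [e' [ O [t'0 e'1 OO h]]]].
have [v v1 hv] := sol_hess_pair s12 e1 e'1 OO t0 t'0.
apply: le_trans hv _; apply: le_trans (h v v1).
by apply: lerD; [exact: lerB|apply: ler_wpM2l => //; exact: lerB].
Qed.

(** Replacing [M] by 0 shifts the bounds by at most [Lip * enorm M], and at 0 they are nonnegative,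
    since the zero matrix can be compared with every member of the family. *)
Let eqn_values_lb M : lbound (eqn_values M) (- (Lip * enorm M)).
Proof.
move=> c [t [e [ O [t0 e1 OO h]]]].
suff : eqn_values (0 : 'M[R]_12) (c + Lip * enorm M).
  move=> /(eqn_values_ge (lexx 0) e01); rewrite mxtrace0 mul0r lexx => /(_ isT).
  by rewrite -lerBlDr sub0r; apply=> v; rewrite mul0r /qform mulmx0 dot0l.
exists t, e, O; split=> // v v1.
have := h v v1; have := affine_le M v1; rewrite ler_norml => /andP[+ _].
by rewrite mxtrace0 /qform mulmx0 dot0l -/(qform M v); lra.
Qed.

(** For each fixed [A] the function under the infimum changes by at most [D], and this bound does
    not depend on [A]. *)
Lemma eqn_shift M M' D : (forall v, dot v v = 1 -> \tr (M' - M) + K * qform (M' - M) v <= D) ->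
  eqn M' <= eqn M + D.
Proof.
move=> hD; rewrite -lerBlDr; apply: lb_le_inf; first exact: eqn_values_neq0.
move=> c [t [e [ O [t0 e1 OO h]]]]; rewrite lerBlDr; apply: ge_inf.
  by exists (- (Lip * enorm M')); exact: eqn_values_lb.
exists t, e, O; split=> // v v1; have := h v v1; have := hD v v1.
by rewrite raddfB /= qformD qformNmx; lra.
Qed.

Lemma eqn_lipschitz : lipschitz_sym eqn.
Proof.
exists Lip => M N _ _; rewrite ler_norml.
have h (M' N' : 'M[R]_12) : eqn M' <= eqn N' + Lip * enorm (M' - N').
  by apply: eqn_shift => v v1; apply: le_trans (ler_norm _) (affine_le _ v1).
have := h M N; have := h N M; rewrite -(enormN (N - M)) opprB => ? ?.
by apply/andP; split; lra.
Qed.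

Lemma eqn_elliptic : uniformly_elliptic eqn.
Proof.
exists Lip => // M N _ Npsd; have N0 := enorm_ge0 N.
have Nv v : 0 <= qform N v by case: Npsd => _ /(_ v); rewrite /qform dotE.
have up : eqn (M + N) <= eqn M + Lip * enorm N.
  apply: eqn_shift => v v1; rewrite addrAC subrr add0r.
  by apply: le_trans (ler_norm _) (affine_le _ v1).
(* Adding [N >= 0] raises the trace by [\tr N] and does not lower the top eigenvalue. *)
have low : eqn M <= eqn (M + N) + - \tr N.
  apply: eqn_shift => v v1; rewrite opprD addrA subrr add0r raddfN /= qformNmx.
  by rewrite mulrN gerDl oppr_le0 mulr_ge0.
have := enorm_le_mxtrace Npsd.
have : Lip^-1 * enorm N <= enorm N by rewrite ler_piMl // invf_le1 // (lt_le_trans ltr01).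
by move=> ? ?; apply/andP; split; lra.
Qed.

(** The family is stable under rotation, which sends [O'] to [O^T *m O']. *)
Lemma eqn_values_congr O M : O *m O^T = 1%:M ->
  eqn_values M `<=` eqn_values (O^T *m M *m O).
Proof.
move=> OO c [t [e [ O' [t0 e1 OO' h]]]].
have OO2 : O^T *m O = 1%:M by exact: mulmx1C.
exists t, e, (O^T *m O'); split=> //.
  by rewrite trmx_mul trmxK !mulmxA -(mulmxA _ O') OO' mulmx1 OO2.
move=> v v1; have vO : dot (v *m O^T) (v *m O^T) = 1.
  by rewrite dot_mulmxl trmxK -mulmxA OO2 mulmx1.
have trE : \tr (O^T *m M *m O) = \tr M by rewrite mxtrace_mulC mulmxA OO mul1mx.
by have := h _ vO; rewrite qform_congr trE mulmxA.
Qed.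

Lemma eqn_invariant : orthogonal_invariant eqn.
Proof.
move=> O S OO _; congr inf; have OO2 : O *m O^T = 1%:M by exact: mulmx1C.
apply/seteqP; split; last exact: eqn_values_congr.
have := @eqn_values_congr O^T (O^T *m S *m O); rewrite trmxK => /(_ OO).
by rewrite -!mulmxA OO2 mulmx1 !mulmxA OO2 mul1mx.
Qed.

Lemma eqn_ge0 (t : R) e M : 0 <= t -> dot e e = 1 ->
  (forall v, t * sol_hess s e v <= qform M v) -> 0 <= eqn M.
Proof.
move=> t0 e1 qM; apply: lb_le_inf; first exact: eqn_values_neq0.
move=> c; apply: (eqn_values_ge t0 e1) => //.
rewrite /T -(sol_hess_trace s e1 I1) mulr_sumr; apply: ler_sum => i _.
by rewrite mulmx1 -qform_delta.
Qed.

(** The Hessian itself, with trivial rotation, competes in the infimum and yields the bound 0. *)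
Lemma eqn_le0 (t : R) e M : 0 <= t -> dot e e = 1 ->
  (forall v, qform M v <= t * sol_hess s e v) -> eqn M <= 0.
Proof.
move=> t0 e1 qM; apply: ge_inf; first by exists (- (Lip * enorm M)); exact: eqn_values_lb.
exists t, e, 1%:M; split=> // v v1; rewrite mulmx1.
have trM : \tr M <= t * T e.
  rewrite /T -(sol_hess_trace s e1 I1) mulr_sumr; apply: ler_sum => i _.
  by rewrite mulmx1 -qform_delta.
have : 0 <= K * (t * sol_hess s e v - qform M v) by rewrite mulr_ge0 ?subr_ge0.
by lra.
Qed.

End Equation.

(** * Test functions touching the solution *)

Section Touching.
Variables (R : realType) (delta : R).
Implicit Types (x v : 'rV[R]_12) (phi : 'rV[R]_12 -> R).

Lemma w_deltaN x : w_delta delta (- x) = - w_delta delta x.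
Proof. by rewrite !w_deltaE cubicPN dotNl dotNr opprK mulNr. Qed.

Lemma w_delta0 : w_delta delta 0 = 0.
Proof. by rewrite /w_delta eqxx. Qed.

(** Away from the origin, the second derivative test along every line through [x]. At the origin
    [t = 0], and the unit vector is arbitrary. *)
Lemma hessian_touching x phi : C2_near x phi ->
  exists t e, [/\ 0 <= t, dot e e = 1,
  local_max (w_delta delta \- phi) x ->
    forall v, t * sol_hess (1 + delta) e v <= qform (hessian phi x) v &
  local_min (w_delta delta \- phi) x ->
    forall v, qform (hessian phi x) v <= t * sol_hess (1 + delta) e v].
Proof.
move=> c2; have [x0|x0] := eqVneq x 0.
  exists 0, (delta_mx 0 0); split=> //; first exact: dot_delta.
    move=> mx v; rewrite mul0r.
    have [g1 [h1 d1]] := hessian_line v c2; have [g2 [h2 d2]] := hessian_line (- v) c2.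
    (* Adding the inequalities along [v] and [- v] cancels the odd solution, so the even part of
       [phi] on the line has a minimum at 0. *)
    have : 0 <= qform (hessian phi x) v + qform (hessian phi x) (- v).
      apply: (second_derivative_min (f := fun t => phi (x + t *: v) + phi (x + t *: - v))
        (f' := fun t => g1 t + g2 t)).
      - by near=> t; apply: is_deriveD; near: t.
      - near=> t.
        have : (w_delta delta \- phi) (x + t *: v) <= (w_delta delta \- phi) x.
          by near: t; exact: (near_line _ mx).
        have : (w_delta delta \- phi) (x + t *: - v) <= (w_delta delta \- phi) x.
          by near: t; exact: (near_line _ mx).
        rewrite /= !scale0r !addr0 x0 !add0r scalerN w_deltaN.
        rewrite w_delta0.
        move: (w_delta delta _) (phi (t *: v)) (phi (- (t *: v))) (phi 0) => a b c d; lra.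
    by rewrite {2}/qform mulNmx dotNl dotNr opprK -/(qform _ v); lra.
  move=> mx v; rewrite mul0r.
  have [g1 [h1 d1]] := hessian_line v c2; have [g2 [h2 d2]] := hessian_line (- v) c2.
  have : 0 <= - qform (hessian phi x) v - qform (hessian phi x) (- v).
    apply: (second_derivative_min (f := fun t => - phi (x + t *: v) - phi (x + t *: - v))
      (f' := fun t => - g1 t - g2 t)).
    - by near=> t; apply: is_deriveB; [apply: is_deriveN|]; near: t.
    - near=> t.
      have : (w_delta delta \- phi) x <= (w_delta delta \- phi) (x + t *: v).
        by near: t; exact: (near_line _ mx).
      have : (w_delta delta \- phi) x <= (w_delta delta \- phi) (x + t *: - v).
        by near: t; exact: (near_line _ mx).
      rewrite /= !scale0r !addr0 x0 !add0r scalerN w_deltaN.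
      rewrite w_delta0.
      move: (w_delta delta _) (phi (t *: v)) (phi (- (t *: v))) (phi 0) => a b c d; lra.
  by rewrite {2}/qform mulNmx dotNl dotNr opprK -/(qform _ v); lra.
exists (enorm x * dot x x `^ (- (1 + delta) / 2)), ((enorm x)^-1 *: x); split.
- by rewrite mulr_ge0 ?powR_ge0 ?enorm_ge0.
- exact: dot_normalize.
- move=> mx v; rewrite -subr_ge0.
  have [g1 [h1 d1]] := hessian_line v c2; have [g2 [h2 d2]] := w_delta_line delta v x0.
  apply: (second_derivative_min (f := fun t => phi (x + t *: v) - w_delta delta (x + t *: v))
        (f' := fun t => g1 t - g2 t)).
  + by near=> t; apply: is_deriveB; near: t.
  + near=> t.
    have : (w_delta delta \- phi) (x + t *: v) <= (w_delta delta \- phi) x.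
      by near: t; exact: (near_line _ mx).
    by rewrite /= !scale0r !addr0 -lerN2 !opprB.
- move=> mx v; rewrite -subr_ge0.
  have [g1 [h1 d1]] := hessian_line v c2; have [g2 [h2 d2]] := w_delta_line delta v x0.
  apply: (second_derivative_min (f := fun t => w_delta delta (x + t *: v) - phi (x + t *: v))
        (f' := fun t => g2 t - g1 t)).
  + by near=> t; apply: is_deriveB; near: t.
  + near=> t.
    have : (w_delta delta \- phi) x <= (w_delta delta \- phi) (x + t *: v).
      by near: t; exact: (near_line _ mx).
    by rewrite /= !scale0r !addr0.
Unshelve. all: by end_near.
Qed.

End Touching.

Theorem theorem1p1 (R : realType) (delta : R) (hdelta : 0 <= delta < 1) :
  exists F : 'M[R]_12 -> R,
    [/\ lipschitz_sym F,
        uniformly_elliptic F,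
        orthogonal_invariant F
      & viscosity_solution F (@unit_ball R 12) (w_delta delta)].
Proof.
have s12 : 1 <= 1 + delta < 2 by move: hdelta => /andP[? ?]; apply/andP; split; lra.
exists (eqn (1 + delta)); split.
- exact: eqn_lipschitz.
- exact: eqn_elliptic.
- exact: eqn_invariant.
split; first exact/continuous_subspaceT/w_delta_continuous.
move=> x phi _ c2; have [t [e [t0 e1 hmax hmin]]] := hessian_touching delta c2.
split; first by move=> /hmax; exact: eqn_ge0.
by move=> /hmin; exact: eqn_le0.
Qed.
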